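(* Let $T$ be a complete first-order theory in an at most countable language with infinite models, and let $M$ be a monster model of $T$. Suppose $p\in S_1(T)$ is a simple type, witnessed by an infinite set $C\subseteq \mathrm{dcl}(\emptyset)$ and a $\emptyset$-definable linear order $(D,<)$. Then for every countable discrete linear order $\mathbb L$ without end-points there is a countable model $M_{\mathbb L}\models T$ (an elementary substructure of $M$) such that $(p(M_{\mathbb L}),<)\cong \mathbb L$. In particular, $I(\aleph_0,T)=2^{\aleph_0}$.
   Context: $M$ is a monster (sufficiently saturated) model of $T$; ''definable'' means without parameters unless parameters are indicated. $\mathrm{dcl}(A)$ is the definable closure of $A$. For a set $A$ and $C\subseteq\mathrm{dcl}(A)$, a partial type over $A$ is finitely satisfied in $C$ if each of its formulas is satisfied by some element of $C$; a complete type $q\in S_1(A)$ is a $C$-type if it is an accumulation point (in the Stone space $S_1(A)$) of $\{\mathrm{tp}(c/A)\mid c\in C\}$. A type $p\in S_1(A)$ is simple, witnessed by an infinite $C\subseteq \mathrm{dcl}(A)$ and an $A$-definable linear order $(D,<)$, if (1) $p$ is the unique $C$-type in $S_1(A)$, and (2) $C$ is an initial part of $(D,<)$ and $(C,<)$ has order type $\omega$. $p(N)$ is the set of realizations of $p$ in $N$. $I(\aleph_0,T)$ is the number of countable models of $T$ up to isomorphism. *)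

(* Defs.v *)
(* Models of arbitrary cardinality live in one fixed universe of types. *)
From HB Require Import structures.
From mathcomp Require Import all_boot all_order.
From mathcomp Require Import boolp classical_sets functions cardinality.
From mathcomp Require Import topology.

Set Implicit Arguments.
Unset Strict Implicit.
Unset Printing Implicit Defensive.

Local Open Scope classical_set_scope.

(** * First-order logic *)

Record language := Language {
  fsym : Type;
  fsym_arity : fsym -> nat;
  rsym : Type;
  rsym_arity : rsym -> nat }.

Definition countable_language (L : language) : Prop :=
  countable [set: fsym L] /\ countable [set: rsym L].

(* [term L n] and [formula L n] have their free variables among x_0..x_(n-1);
   so [formula L 0] is the type of sentences. In [fall phi], the bound variable
   is x_0 of [phi] and x_i of [fall phi] is x_(i+1) of [phi]. *)
Inductive term (L : language) (n : nat) : Type :=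
| tvar of 'I_n
| tapp (f : fsym L) of ('I_(fsym_arity f) -> term L n).

Inductive formula (L : language) : nat -> Type :=
| fbot n : formula L n
| feq n of term L n & term L n : formula L n
| frel n (r : rsym L) of ('I_(rsym_arity r) -> term L n) : formula L n
| fimp n of formula L n & formula L n : formula L n
| fall n of formula L n.+1 : formula L n.

Arguments fbot {L n}.

Definition fneg L n (phi : formula L n) : formula L n := fimp phi fbot.
Definition fand L n (phi psi : formula L n) : formula L n :=
  fneg (fimp phi (fneg psi)).

Record structure (L : language) := Structure {
  carrier :> Type;
  carrier_nonempty : inhabited carrier;
  fun_of : forall f : fsym L, ('I_(fsym_arity f) -> carrier) -> carrier;
  rel_of : forall r : rsym L, ('I_(rsym_arity r) -> carrier) -> Prop }.

Arguments fun_of {L} s f v.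
Arguments rel_of {L} s r v.

(* The assignment x_0 := a, x_(i+1) := v i *)
Definition scons (X : Type) n (a : X) (v : 'I_n -> X) : 'I_n.+1 -> X :=
  fun i => oapp v a (unlift ord0 i).

Definition snil (X : Type) : 'I_0 -> X :=
  fun i => match notF (ltn_ord i) with end.

Fixpoint teval L (M : structure L) n (v : 'I_n -> M) (t : term L n) : M :=
  match t with
  | tvar i => v i
  | tapp f ts => fun_of M f (fun i => teval v (ts i))
  end.

Fixpoint sat L (M : structure L) n (phi : formula L n) : ('I_n -> M) -> Prop :=
  match phi in formula _ n return ('I_n -> M) -> Prop with
  | fbot _ => fun _ => False
  | feq _ t u => fun v => teval v t = teval v u
  | frel _ r ts => fun v => rel_of M r (fun i => teval v (ts i))
  | fimp _ phi psi => fun v => sat phi v -> sat psi v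
  | fall _ phi => fun v => forall a : M, sat phi (scons a v)
  end.

Arguments sat {L} M {n} phi v.

Definition holds L (M : structure L) (phi : formula L 0) : Prop :=
  sat M phi (@snil M).

Definition sat1 L (M : structure L) (phi : formula L 1) (a : M) : Prop :=
  sat M phi (scons a (@snil M)).

Definition theory (L : language) := set (formula L 0).

Definition models L (M : structure L) (T : theory L) : Prop :=
  forall phi, T phi -> holds M phi.

Definition entails L (T : theory L) (phi : formula L 0) : Prop :=
  forall M : structure L, models M T -> holds M phi.

Definition complete_theory L (T : theory L) : Prop :=
  (exists M : structure L, models M T) /\
  forall phi, entails T phi \/ entails T (fneg phi).

Definition has_infinite_model L (T : theory L) : Prop :=
  exists M : structure L, models M T /\ infinite_set [set: M].

(** * Elementary substructures and isomorphisms *)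

Definition fun_closed L (M : structure L) (A : set M) : Prop :=
  forall f (v : 'I_(fsym_arity f) -> M), (forall i, A (v i)) -> A (fun_of M f v).

Lemma sig_inhabited (X : Type) (A : set X) : A !=set0 -> inhabited {x | A x}.
Proof. by case=> x Ax; split; exists x. Qed.

Definition substructure L (M : structure L) (A : set M)
    (A0 : A !=set0) (clA : fun_closed A) : structure L :=
  @Structure L {x : M | A x} (sig_inhabited A0)
    (fun f v => exist A (fun_of M f (fun i => sval (v i)))
                        (clA f _ (fun i => svalP (v i))))
    (fun r v => rel_of M r (fun i => sval (v i))).

Record elementary_substructure L (M : structure L) := ElementarySubstructure {
  es_set : set M;
  es_nonempty : es_set !=set0;
  es_closed : fun_closed es_set;
  es_structure :> structure L := substructure es_nonempty es_closed;
  es_elementary : forall n (phi : formula L n) (v : 'I_n -> es_structure),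
    sat es_structure phi v <-> sat M phi (fun i => sval (v i)) }.

Definition isomorphic L (M N : structure L) : Prop :=
  exists h : M -> N, [/\ bijective h,
    forall f (v : 'I_(fsym_arity f) -> M),
      h (fun_of M f v) = fun_of N f (fun i => h (v i))
  & forall r (v : 'I_(rsym_arity r) -> M),
      rel_of M r v <-> rel_of N r (fun i => h (v i))].

(* T has exactly |K| countable models up to isomorphism: K indexes a system of
   representatives of their isomorphism classes. *)
Definition number_of_countable_models L (T : theory L) (K : Type) : Prop :=
  exists F : K -> structure L,
    [/\ forall k, models (F k) T /\ countable [set: F k],
        forall k l, isomorphic (F k) (F l) -> k = l
      & forall N : structure L, models N T -> countable [set: N] ->
          exists k, isomorphic N (F k)].

(** * Saturation *)

(* A formula in the free variable x_0, with parameters [pf_par i] substituted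
   for x_(i+1). *)
Record pformula L (M : structure L) := PFormula {
  pf_arity : nat;
  pf_formula : formula L pf_arity.+1;
  pf_par : 'I_pf_arity -> M }.

Arguments pf_par {L M} p i.

Definition psat L (M : structure L) (phi : pformula M) (a : M) : Prop :=
  sat M (pf_formula phi) (scons a (pf_par phi)).

Definition aleph1_saturated L (M : structure L) : Prop :=
  forall (A : set M) (S : set (pformula M)), countable A ->
    (forall phi, S phi -> forall i, A (pf_par phi i)) ->
    (forall S0, finite_set S0 -> S0 `<=` S ->
       exists a, forall phi, S0 phi -> psat phi a) ->
    exists a, forall phi, S phi -> psat phi a.

(* Only saturation is demanded of the monster model: aleph_1-saturation is
   implied by kappa-saturation for any uncountable kappa. *)
Definition monster_model L (T : theory L) (M : structure L) : Prop :=
  models M T /\ aleph1_saturated M.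

(** * Definability without parameters *)

Definition definable L (M : structure L) n (X : set ('I_n -> M)) : Prop :=
  exists phi : formula L n, X = [set v | sat M phi v].

Definition definable_set L (M : structure L) (D : set M) : Prop :=
  definable [set v : 'I_1 -> M | D (v ord0)].

Definition definable_rel L (M : structure L) (R : M -> M -> Prop) : Prop :=
  definable [set v : 'I_2 -> M | R (v ord0) (v ord_max)].

Definition dcl0 L (M : structure L) : set M :=
  [set b | definable_set [set b]].

Arguments dcl0 {L} M.

(** * The Stone space S_1(T) *)

Definition complete_type L (T : theory L) (p : set (formula L 1)) : Prop :=
  (forall s, finite_set s -> s `<=` p ->
     exists (N : structure L) (a : N),
       models N T /\ forall phi, s phi -> sat1 phi a) /\
  (forall phi, p phi \/ p (fneg phi)).

Definition stone1 L (T : theory L) : Type :=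
  {p : set (formula L 1) | complete_type T p}.

Section StoneTopology.
Variables (L : language) (T : theory L).

Lemma complete_type_and (p : set (formula L 1)) phi psi :
  complete_type T p -> p phi -> p psi -> p (fand phi psi).
Proof.
move=> [fs cp] pphi ppsi; case: (cp (fand phi psi)) => // pn.
have [||N [a [_ h]]] := fs [set phi; psi; fneg (fand phi psi)].
- by rewrite !finite_setU; split=> //; split.
- by move=> x [[->|->]|->].
have h1 := h phi (or_introl (or_introl erefl)).
have h2 := h psi (or_introl (or_intror erefl)).
have h3 := h _ (or_intror erefl).
by exfalso; apply: h3 => h4; exact: h4 h1 h2.
Qed.

Definition stone1_open : set (set (stone1 T)) :=
  [set U | forall q, U q ->
     exists2 phi, sval q phi & [set r : stone1 T | sval r phi] `<=` U].

Lemma stone1_openT : stone1_open setT.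
Proof. by move=> q _; case: (proj2 (svalP q) fbot) => h; eexists; eauto. Qed.

Lemma stone1_openI (U V : set (stone1 T)) :
  stone1_open U -> stone1_open V -> stone1_open (U `&` V).
Proof.
move=> oU oV q [Uq Vq].
have [phi qphi sU] := oU q Uq; have [psi qpsi sV] := oV q Vq.
exists (fand phi psi); first exact: complete_type_and (svalP q) qphi qpsi.
move=> r rand; have [fs cp] := svalP r.
split; [apply: sU | apply: sV]; rewrite /=.
- case: (cp phi) => // rn.
  have [||N [a [_ h]]] := fs [set fneg phi; fand phi psi].
  + by rewrite finite_setU.
  + by move=> x [->|->].
  have h1 := h _ (or_introl erefl); have h2 := h _ (or_intror erefl).
  by exfalso; apply: h2 => /h1.
- case: (cp psi) => // rn.
  have [||N [a [_ h]]] := fs [set fneg psi; fand phi psi].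
  + by rewrite finite_setU.
  + by move=> x [->|->].
  have h1 := h _ (or_introl erefl); have h2 := h _ (or_intror erefl).
  by exfalso; apply: h2 => _ /h1.
Qed.

Lemma stone1_open_bigU (I : Type) (F : I -> set (stone1 T)) :
  (forall i, stone1_open (F i)) -> stone1_open (\bigcup_i F i).
Proof.
move=> oF q [i _ Fq]; have [phi qphi sF] := oF i q Fq.
by exists phi => // r /sF Fr; exists i.
Qed.

HB.instance Definition _ := gen_eqMixin (stone1 T).
HB.instance Definition _ := gen_choiceMixin (stone1 T).
HB.instance Definition _ :=
  isOpenTopological.Build (stone1 T) stone1_openT stone1_openI stone1_open_bigU.

End StoneTopology.

Definition tp L (M : structure L) (a : M) : set (formula L 1) :=
  [set phi | sat1 phi a].

Definition realizations L T (p : stone1 T) (N : structure L) : set N :=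
  [set a | forall phi, sval p phi -> sat1 phi a].

Arguments realizations {L T} p N.

Definition C_type L (T : theory L) (M : structure L) (C : set M)
    (q : stone1 T) : Prop :=
  limit_point [set r : stone1 T | exists2 c, C c & sval r = tp c] q.

(** * Linear orders and simple types *)

Definition linear_order_on (X : Type) (D : set X) (lt : X -> X -> Prop) : Prop :=
  [/\ forall x, D x -> ~ lt x x,
      forall x y z, D x -> D y -> D z -> lt x y -> lt y z -> lt x z
    & forall x y, D x -> D y -> [\/ lt x y, x = y | lt y x]].

Definition initial_part (X : Type) (D : set X) (lt : X -> X -> Prop)
    (C : set X) : Prop :=
  C `<=` D /\ forall x y, C x -> D y -> lt y x -> C y.

(* (A, lt) is isomorphic to the linear order O *)
Definition has_order_type (X : Type) (A : set X) (lt : X -> X -> Prop)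
    (d : Order.disp_t) (O : orderType d) : Prop :=
  exists f : O -> X, set_bij [set: O] A f /\
    forall i j, (i < j)%O <-> lt (f i) (f j).

Definition without_endpoints (d : Order.disp_t) (O : orderType d) : Prop :=
  forall x : O, (exists y, (y < x)%O) /\ (exists y, (x < y)%O).

Definition immediate_succ (d : Order.disp_t) (O : orderType d) (x y : O) : Prop :=
  (x < y)%O /\ forall z, ~ ((x < z)%O /\ (z < y)%O).

Definition discrete_order (d : Order.disp_t) (O : orderType d) : Prop :=
  forall x : O,
    ((exists y, (x < y)%O) -> exists y, immediate_succ x y) /\
    ((exists y, (y < x)%O) -> exists y, immediate_succ y x).

Record simple_type L (T : theory L) (M : structure L) (p : stone1 T)
    (C D : set M) (lt : M -> M -> Prop) : Prop := SimpleType {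
  simple_C_infinite : infinite_set C;
  simple_C_dcl : C `<=` dcl0 M;
  simple_D_definable : definable_set D;
  simple_lt_definable : definable_rel lt;
  simple_linear : linear_order_on D lt;
  simple_C_type : C_type C p;
  simple_C_type_unique : forall q : stone1 T, C_type C q -> q = p;
  simple_initial : initial_part D lt C;
  simple_omega : has_order_type C lt nat }.

(* Main.v *)
(* Uniqueness of [p] means that every 0-definable set is finite or cofinite on
   C = {c_0 < c_1 < ...}, and [p] consists of the formulas true of almost all
   [c_n]. This constrains definable relations on C in several variables: far
   out they are invariant under the shift, and consequently the value of a
   definable function is bounded or at bounded distance from an argument.
   Statements with quantifiers bounded by [w] transfer from [w] in C to
   realizations [w] of [p]. So a set that is definable over realizations A of
   [p] and contains only realizations of [p] has a least element, and this
   element lies at finite distance from A. If A is closed under predecessor and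
   successor, the type of a new realization is therefore not isolated over A
   and can be omitted; the given order is embedded as such an A into [p(M)] by
   saturation. Finally, the orders ([sum_i (Q + F_i)] x Z), with [F_i] empty or
   a chain of [i + 2] elements, are pairwise non-isomorphic. *)
Require Import Defs.
From mathcomp Require Import all_boot all_order all_algebra.
From mathcomp Require Import boolp classical_sets functions cardinality.
From mathcomp Require Import topology.
From mathcomp Require Import zify lra.

Set Implicit Arguments.
Unset Strict Implicit.
Unset Printing Implicit Defensive.

Local Open Scope classical_set_scope.
(** * Definable relations over environments *)

(** The dichotomy between finite and cofinite concerns one variable only, and [C] is not definable,
    so a quantifier of [M] can be confined to [C] only by a bound in [C]. Statements about [C] are
    therefore brought to bounded form. This serves twice: a bounded statement about tuples becomes a
    condition on the bounds alone, within reach of the dichotomy, and it keeps its meaning when the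
    bound is replaced by a realization of [p]. Shift invariance controls definable functions because
    a configuration with only large entries can be moved as a whole towards the origin until an
    entry becomes a constant. An element at finite distance from a parameter is definable over it
    and cannot be omitted from a model containing the parameter; so the prescribed realizations must
    be closed under both neighbours, which is the use of discreteness and of the absence of
    end-points. The factor Z turns any linear order into a discrete one without end-points, and its
    copies are recognizable as the classes of points at finite distance. *)

Definition ecns (X : Type) (a : X) (e : nat -> X) : nat -> X :=
  fun i => if i is j.+1 then e j else a.

Lemma scons_ecns (X : Type) n (a : X) (e : nat -> X) (i : 'I_n.+1) :
  scons a (fun j : 'I_n => e j) i = ecns a e i.
Proof. by rewrite /scons; case: unliftP => [j ->|->]. Qed.

Lemma comp_ecns (X Y : Type) (f : X -> Y) (a : X) (e : nat -> X) :
  (fun i => f (ecns a e i)) = ecns (f a) (fun i => f (e i)).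
Proof. by apply/funext => -[]. Qed.

Section Renaming.
Variable L : language.

Fixpoint tren n m (r : 'I_n -> 'I_m) (t : term L n) : term L m :=
  match t with
  | tvar i => tvar _ (r i)
  | tapp f ts => tapp (fun i => tren r (ts i))
  end.

Definition rlift n m (r : 'I_n -> 'I_m) : 'I_n.+1 -> 'I_m.+1 :=
  scons ord0 (fun i => lift ord0 (r i)).

Fixpoint fren n (phi : formula L n) : forall m, ('I_n -> 'I_m) -> formula L m :=
  match phi in formula _ n return forall m, ('I_n -> 'I_m) -> formula L m with
  | fbot _ => fun m r => fbot
  | feq _ t u => fun m r => feq (tren r t) (tren r u)
  | Defs.frel _ s ts => fun m r => @Defs.frel L m s (fun i => tren r (ts i))
  | fimp _ phi psi => fun m r => fimp (fren phi r) (fren psi r)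
  | fall _ phi => fun m r => fall (fren phi (rlift r))
  end.

Lemma teval_tren (M : structure L) n m (r : 'I_n -> 'I_m) t (v : 'I_m -> M) :
  teval v (tren r t) = teval (fun i => v (r i)) t.
Proof.
by elim: t => //= f ts IH; congr fun_of; apply/funext => i; exact: IH.
Qed.

Lemma sat_fren (M : structure L) n (phi : formula L n) m (r : 'I_n -> 'I_m)
  (v : 'I_m -> M) : sat M (fren phi r) v = sat M phi (fun i => v (r i)).
Proof.
elim: phi m r v => {n} [n|n t u|n s ts|n phi IH psi IH2|n phi IH] m r v //=.
- by rewrite !teval_tren.
- by congr rel_of; apply/funext => i; rewrite teval_tren.
- by rewrite IH IH2.
- apply: eq_forall => a; rewrite IH; congr sat; apply/funext => k.
  rewrite /rlift /scons; case: (unliftP ord0 k) => [j _|_] /=.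
    by rewrite liftK.
  by rewrite unlift_none.
Qed.

End Renaming.

Section Definable.
Variables (L : language) (M : structure L).
Implicit Types P Q : (nat -> M) -> Prop.

(** With predicates on infinite environments, variables are plain numbers and renaming is
    composition with any map on [nat]; definability is then derived from closure properties instead
    of explicit formulas. *)
Definition dfb P : Prop :=
  exists n (phi : formula L n), forall e, P e <-> sat M phi (fun i => e i).

Lemma dfb_ext P Q : (forall e, P e <-> Q e) -> dfb P -> dfb Q.
Proof. by move=> PQ; have -> : P = Q by apply/funext => e; apply/propext. Qed.

Lemma dfb_widen P : dfb P -> exists n, forall m, n <= m ->
  exists phi : formula L m, forall e, P e <-> sat M phi (fun i => e i).
Proof.
case=> n [phi hphi]; exists n => m nm; exists (fren phi (widen_ord nm)) => e.
by rewrite sat_fren; exact: hphi.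
Qed.

Lemma dfb_imp P Q : dfb P -> dfb Q -> dfb (fun e => P e -> Q e).
Proof.
move=> /dfb_widen[n hP] /dfb_widen[m hQ].
have [phi hphi] := hP _ (leq_maxl n m); have [psi hpsi] := hQ _ (leq_maxr n m).
exists (maxn n m), (fimp phi psi) => e /=.
by split=> h; [move=> /hphi/h/hpsi | move=> /hphi/h/hpsi].
Qed.

Lemma dfb_const (P : Prop) : dfb (fun=> P).
Proof.
have [p|np] := pselect P.
  by exists 0, (fneg fbot) => e /=; split.
by exists 0, fbot => e /=; split.
Qed.

Lemma dfb_not P : dfb P -> dfb (fun e => ~ P e).
Proof. by move=> h; apply: dfb_imp => //; exact: dfb_const. Qed.

Lemma dfb_and P Q : dfb P -> dfb Q -> dfb (fun e => P e /\ Q e).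
Proof.
move=> hP hQ; apply: (@dfb_ext (fun e => ~ (P e -> ~ Q e))).
  by move=> e; split=> [/not_implyP[? /contrapT]|[? ?]]; tauto.
by apply: dfb_not; apply: dfb_imp => //; exact: dfb_not.
Qed.

Lemma dfb_or P Q : dfb P -> dfb Q -> dfb (fun e => P e \/ Q e).
Proof.
move=> hP hQ; apply: (@dfb_ext (fun e => ~ P e -> Q e)).
  by move=> e; split=> [h|]; [case: (pselect (P e)); tauto | tauto].
by apply: dfb_imp => //; exact: dfb_not.
Qed.

Lemma dfb_ren (r : nat -> nat) P : dfb P -> dfb (fun e => P (fun i => e (r i))).
Proof.
case=> n [phi hphi].
have rlt (i : 'I_n) : r i < \max_(j < n) (r j).+1.
  exact: (@leq_bigmax _ (fun j : 'I_n => (r j).+1) i).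
exists (\max_(j < n) (r j).+1), (fren phi (fun i => Ordinal (rlt i))) => e.
by rewrite sat_fren; exact: hphi.
Qed.

Lemma dfb_all (P : M -> (nat -> M) -> Prop) :
  dfb (fun e => P (e 0) (fun i => e i.+1)) -> dfb (fun e => forall a, P a e).
Proof.
move=> /dfb_widen[n /(_ _ (leqnSn n))[phi hphi]]; exists n, (fall phi) => e /=.
split=> h a; last first.
  apply/(hphi (ecns a e)); have := h a; congr sat.
  by apply/funext => i; rewrite scons_ecns.
have /(hphi (ecns a e)) := h a; congr sat.
by apply/funext => i; rewrite scons_ecns.
Qed.

Lemma dfb_ex (P : M -> (nat -> M) -> Prop) :
  dfb (fun e => P (e 0) (fun i => e i.+1)) -> dfb (fun e => exists a, P a e).
Proof.
move=> h; apply: (@dfb_ext (fun e => ~ forall a, ~ P a e)).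
  by move=> e; split=> [/existsNP[a /contrapT]|[a ha] /(_ a)//]; exists a.
by apply/dfb_not/dfb_all/dfb_not.
Qed.

Lemma dfb_eq i j : dfb (fun e => e i = e j).
Proof.
apply: (@dfb_ren (fun k => if k is 0 then i else j) (fun e => e 0 = e 1)).
exists 2, (feq (tvar _ ord0) (tvar _ ord_max)) => e //.
Qed.

Lemma dfb_alln (P : nat -> (nat -> M) -> Prop) m : (forall i, dfb (P i)) ->
  dfb (fun e => forall i, i < m -> P i e).
Proof.
move=> h; elim: m => [|m IH].
  by apply: (@dfb_ext (fun=> True)); [move=> e; split | exact: dfb_const].
apply: dfb_ext (dfb_and IH (h m)) => e; split=> [[h1 h2] i|h1].
  by rewrite ltnS leq_eqVlt => /predU1P[->//|]; exact: h1.
by split=> [i im|]; apply: h1; rewrite // ltnS ltnW.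
Qed.

Lemma dfb_exn (P : nat -> (nat -> M) -> Prop) m : (forall i, dfb (P i)) ->
  dfb (fun e => exists i, i < m /\ P i e).
Proof.
move=> h; apply: (@dfb_ext (fun e => ~ forall i, i < m -> ~ P i e)).
  move=> e; split=> [/existsNP[i /not_implyP[im /contrapT Pi]]|[i [im Pi]]].
    by exists i.
  by move/(_ i im).
by apply/dfb_not/dfb_alln => i; exact: dfb_not.
Qed.

Definition ecat m (v e : nat -> M) : nat -> M :=
  fun i => if i < m then v i else e (i - m).

(** [ecat m v e] reads only the first [m] entries of [v], so this is a block of [m] first-order
    quantifiers, added one at a time. *)
Lemma dfb_exv m P : dfb P -> dfb (fun e => exists v, P (ecat m v e)).
Proof.
move=> hP; elim: m => [|m IH].
  apply: dfb_ext hP => e; have E v : ecat 0 v e = e.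
    by apply/funext => i; rewrite /ecat subn0.
  by split=> [|[v]]; [exists e|]; rewrite E.
have {}IH : dfb (fun e => exists a v, P (ecat m v (ecns a e))).
  apply: dfb_ex; apply: dfb_ext IH => e.
  by have -> : ecns (e 0) (fun i => e i.+1) = e by apply/funext => -[].
apply: dfb_ext IH => e; split=> [[a [v h]]|[v h]].
  exists (fun i => if i < m then v i else a); move: h; congr P.
  apply/funext => i; rewrite /ecat ltnS.
  case: (ltngtP i m) => [//|mi|->]; last by rewrite subnn.
  by rewrite -(@subnSK m i).
exists (v m), v; move: h; congr P; apply/funext => i; rewrite /ecat ltnS.
case: (ltngtP i m) => [//|mi|->]; last by rewrite subnn.
by rewrite -(@subnSK m i).
Qed.

Definition supported (X : Type) m (P : (nat -> X) -> Prop) : Prop :=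
  forall e e', (forall i, i < m -> e i = e' i) -> P e -> P e'.

Lemma dfb_supported P : dfb P -> exists m, forall n, m <= n -> supported n P.
Proof.
case=> m [phi h]; exists m => n mn e e' ee' /h Pe; apply/h; move: Pe; congr sat.
by apply/funext => i; rewrite ee' // (leq_trans (ltn_ord i)).
Qed.

(** [I] may be infinite, but only its indices in the support of [P] constrain anything; beyond it
    the witness copies the prescribed values. The result serves as the set of values that a
    condition leaves open for coordinate [j]. *)
Lemma dfb_proj (I : pred nat) j P : dfb P ->
  dfb (fun e => exists v, [/\ forall i, I i -> v i = e i.+1, v j = e 0 & P v]).
Proof.
move=> hP; have [m0 /(_ (maxn m0 j.+1) (leq_maxl _ _)) supP] := dfb_supported hP.
set m := maxn m0 j.+1 in supP *.
have jm : j < m by rewrite leq_max ltnSn orbT.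
have h : dfb (fun e => ((forall i, i < m -> I i -> e i = e (m + i.+1)) /\
     e j = e m) /\ P e).
  apply: dfb_and => //; apply: dfb_and; last exact: dfb_eq.
  apply: dfb_alln => i; apply: dfb_imp; [exact: dfb_const | exact: dfb_eq].
apply: dfb_ext (@dfb_exv m _ h) => e; split=> [[v [[h1 h2] h3]]|[v [h1 h2 h3]]].
  exists (fun i => if i < m then v i else e i.+1); split.
  - move=> i Ii; case: ifP => // im; have := h1 i im Ii.
    by rewrite /ecat im ltnNge leq_addr /= addKn.
  - by rewrite jm; move: h2; rewrite /ecat jm ltnn subnn.
  - by apply: supP h3 => i im; rewrite /ecat im.
exists v; split; last by apply: supP h3 => i im; rewrite /ecat im.
split=> [i im Ii|]; first by rewrite /ecat im ltnNge leq_addr /= addKn h1.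
by rewrite /ecat jm ltnn subnn.
Qed.

End Definable.

(** * The structure induced on C *)

Definition ev (P : nat -> Prop) : Prop := exists N, forall n, N <= n -> P n.

Lemma ev_and P Q : ev P -> ev Q -> ev (fun n => P n /\ Q n).
Proof.
move=> [N hN] [N' hN']; exists (maxn N N') => n; rewrite geq_max => /andP[? ?].
by split; [apply: hN | apply: hN'].
Qed.

Lemma ev_imp (P Q : nat -> Prop) : (forall n, P n -> Q n) -> ev P -> ev Q.
Proof. by move=> PQ [N hN]; exists N => n /hN/PQ. Qed.

Lemma ev_fin (I : finType) (P : I -> nat -> Prop) :
  (forall i, ev (P i)) -> ev (fun n => forall i, P i n).
Proof.
move=> /choice[N hN]; exists (\max_i N i) => n h i.
by apply: hN; apply: leq_trans h; exact: leq_bigmax.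
Qed.

Lemma exists_bound_seq (X : eqType) (s : seq X) (Q : X -> nat -> Prop) :
  (forall x k k', k <= k' -> Q x k -> Q x k') ->
  (forall x, x \in s -> exists k, Q x k) ->
  exists k, forall x, x \in s -> Q x k.
Proof.
move=> monoQ; elim: s => [|a s IH] h; first by exists 0.
have [k hk] := IH (fun x xs => h x (mem_behead (s := a :: s) xs)).
have [k' hk'] := h a (mem_head a s).
exists (maxn k k') => x /predU1P[->|/hk hx].
  exact: monoQ (leq_maxr _ _) hk'.
exact: monoQ (leq_maxl _ _) hx.
Qed.

(** All that is retained of simplicity: types disappear, and uniqueness of the limit type survives
    as [chain_eventual]. *)
Record eventual_chain (L : language) (M : structure L) (c : nat -> M)
    (D : set M) (lt : M -> M -> Prop) : Prop := EventualChain {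
  chain_D : forall n, D (c n);
  chain_lt : forall i j, lt (c i) (c j) <-> i < j;
  chain_initial : forall y n, D y -> lt y (c n) -> exists m, y = c m;
  chain_linear : linear_order_on D lt;
  chain_dfb : forall n, dfb (fun e : nat -> M => e 0 = c n);
  chain_dfb_D : dfb (fun e : nat -> M => D (e 0));
  chain_dfb_lt : dfb (fun e : nat -> M => lt (e 0) (e 1));
  chain_eventual : forall P : M -> Prop, dfb (fun e => P (e 0)) ->
    ev (fun n => P (c n)) \/ ev (fun n => ~ P (c n)) }.

Section Chain.
Variables (L : language) (M : structure L) (c : nat -> M).
Variables (D : set M) (lt : M -> M -> Prop).
Hypothesis chn : eventual_chain c D lt.

Let cD := chain_D chn.
Let clt := chain_lt chn.
Let lin := chain_linear chn.

Lemma dfb_c i n : dfb (fun e : nat -> M => e i = c n).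
Proof. exact: (@dfb_ren _ _ (fun=> i) (fun e => e 0 = c n)) (chain_dfb chn n). Qed.

Lemma dfb_D i : dfb (fun e : nat -> M => D (e i)).
Proof. exact: (@dfb_ren _ _ (fun=> i) (fun e => D (e 0))) (chain_dfb_D chn). Qed.

Lemma dfb_lt i j : dfb (fun e : nat -> M => lt (e i) (e j)).
Proof.
exact: (@dfb_ren _ _ (fun k => if k is 0 then i else j)
  (fun e => lt (e 0) (e 1))) (chain_dfb_lt chn).
Qed.

Lemma c_inj : injective c.
Proof.
move=> i j eq_c; have [irr _ _] := lin.
case: (ltngtP i j) => // /clt; rewrite eq_c => h; exfalso; exact: irr h.
Qed.

(** This makes bounded quantifiers over [C] definable: being in [D] and not above [c n] already
    forces an element into [C]. *)
Lemma below_c y n : D y -> ~ lt (c n) y -> exists2 m, m <= n & y = c m.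
Proof.
move=> Dy nlt; have [_ _ tot] := lin.
case: (tot y (c n) Dy (cD n)) => [lt_y|->|//]; last by exists n.
have [m ym] := chain_initial chn Dy lt_y; exists m => //.
by move: lt_y; rewrite ym => /clt/ltnW.
Qed.

(** The trace on [C] of a definable relation, read through indices. Boolean operations and bounded
    quantifiers preserve such traces; an unbounded quantifier of [M] leaves [C]. *)
Definition dI (Q : (nat -> nat) -> Prop) : Prop :=
  exists2 P, dfb P & forall e, Q e <-> P (fun i => c (e i)).

Lemma dI_const (P : Prop) : dI (fun=> P).
Proof. by exists (fun=> P) => //; exact: dfb_const. Qed.

Lemma dI_imp P Q : dI P -> dI Q -> dI (fun e => P e -> Q e).
Proof.
move=> [P' dP hP] [Q' dQ hQ]; exists (fun e => P' e -> Q' e).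
  exact: dfb_imp.
by move=> e; rewrite (propext (hP e)) (propext (hQ e)).
Qed.

Lemma dI_not P : dI P -> dI (fun e => ~ P e).
Proof. by move=> h; apply: dI_imp => //; exact: dI_const. Qed.

Lemma dI_and P Q : dI P -> dI Q -> dI (fun e => P e /\ Q e).
Proof.
move=> [P' dP hP] [Q' dQ hQ]; exists (fun e => P' e /\ Q' e).
  exact: dfb_and.
by move=> e; rewrite (propext (hP e)) (propext (hQ e)).
Qed.

Lemma dI_iff P Q : dI P -> dI Q -> dI (fun e => P e <-> Q e).
Proof. by move=> hP hQ; apply: dI_and; apply: dI_imp. Qed.

Lemma dI_bex j (Q : nat -> (nat -> nat) -> Prop) :
  dI (fun e => Q (e 0) (fun i => e i.+1)) ->
  dI (fun e => exists x, x <= e j /\ Q x e).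
Proof.
move=> [P dP hP].
exists (fun e => exists a, (D a /\ ~ lt (e j) a) /\ P (ecns a e)).
  apply: dfb_ex; apply: dfb_and; last first.
    apply: dfb_ext dP => e.
    by have -> : ecns (e 0) (fun i => e i.+1) = e by apply/funext => -[].
  by apply: dfb_and; [exact: (dfb_D 0)| exact: dfb_not (dfb_lt j.+1 0)].
move=> e; split=> [[x [xj Qx]]|[a [[Da /(below_c Da)[x xj ->]]]]].
  exists (c x); split; first by split=> [|/clt]; [exact: cD | lia].
  by have /hP := Qx : Q (ecns x e 0) (fun i => ecns x e i.+1); rewrite comp_ecns.
by rewrite -comp_ecns => /hP Qx; exists x.
Qed.

(** The equivalence ranges over all [a] in [M], not only over [C], so that an element found by a
    quantifier of [M] is forced to be the intended one. *)
Definition tmI (t : (nat -> nat) -> nat) : Prop :=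
  exists2 G, dfb G &
    forall e a, G (ecns a (fun i => c (e i))) <-> a = c (t e).

Lemma tmI_var i : tmI (fun e => e i).
Proof. by exists (fun e => e 0 = e i.+1) => //; exact: dfb_eq. Qed.

Lemma tmI_const n : tmI (fun=> n).
Proof. by exists (fun e => e 0 = c n) => //; exact: dfb_c. Qed.

Definition imm_succ (x y : M) : Prop :=
  (D x /\ D y) /\ (lt x y /\ forall z, ~ (D z /\ (lt x z /\ lt z y))).

Lemma dfb_imm_succ i j : dfb (fun e : nat -> M => imm_succ (e i) (e j)).
Proof.
apply: dfb_and; first by apply: dfb_and; exact: dfb_D.
apply: dfb_and; first exact: dfb_lt.
apply: dfb_all; apply: dfb_not; apply: dfb_and; first exact: (dfb_D 0).
by apply: dfb_and; [exact: (dfb_lt i.+1 0)|exact: (dfb_lt 0 j.+1)].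
Qed.

Lemma imm_succ_inj_r x y y' : imm_succ x y -> imm_succ x y' -> y = y'.
Proof.
move=> [[Dx Dy] [xy hy]] [[_ Dy'] [xy' hy']]; have [_ _ tot] := lin.
case: (tot y y' Dy Dy') => // h; exfalso.
  by apply: (hy' y); split.
by apply: (hy y'); split.
Qed.

Lemma imm_succ_inj_l x x' y : imm_succ x y -> imm_succ x' y -> x = x'.
Proof.
move=> [[Dx Dy] [xy hy]] [[Dx' _] [xy' hy']]; have [_ _ tot] := lin.
case: (tot x x' Dx Dx') => // h; exfalso.
  by apply: (hy x'); split.
by apply: (hy' x); split.
Qed.

Lemma imm_succ_c n : imm_succ (c n) (c n.+1).
Proof.
split=> //; split=> [|z [Dz [nz zn]]]; first by rewrite clt.
have [m zm] := chain_initial chn Dz zn; move: nz zn; rewrite zm !clt; lia.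
Qed.

Lemma tmI_succ t : tmI t -> tmI (fun e => (t e).+1).
Proof.
move=> [G dG hG].
exists (fun e => exists a, imm_succ a (e 0) /\ G (ecns a (fun i => e i.+1))).
  apply: dfb_ex; apply: dfb_and; first exact: (dfb_imm_succ 0 1).
  apply: dfb_ext (dfb_ren (fun i => if i is j.+1 then j.+2 else 0) dG) => e.
  have -> // : (fun i => e (if i is j.+1 then j.+2 else 0)) =
              ecns (e 0) (fun i => e i.+2) by apply/funext => -[].
move=> e a /=; split=> [[b [ba]]|->].
  by rewrite hG => eb; rewrite eb in ba; apply: imm_succ_inj_r ba (imm_succ_c _).
by exists (c (t e)); split; [exact: imm_succ_c | rewrite hG].
Qed.

Lemma tmI_add t k : tmI t -> tmI (fun e => t e + k).
Proof.
elim: k => [|k IH] ht.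
  by have -> : (fun e => t e + 0) = t by apply/funext => e; rewrite addn0.
have -> : (fun e => t e + k.+1) = fun e => (t e + k).+1.
  by apply/funext => e; rewrite addnS.
exact/tmI_succ/IH.
Qed.

Lemma dI_subst Q (t : nat -> (nat -> nat) -> nat) : dI Q ->
  (forall i, tmI (t i)) -> dI (fun e => Q (fun i => t i e)).
Proof.
move=> [P dP hP] ht.
have /choice[G hG] : forall i, exists G, dfb G /\
    forall e a, G (ecns a (fun i => c (e i))) <-> a = c (t i e).
  by move=> i; have [G dG hG] := ht i; exists G.
have [m /(_ m (leqnn m)) supP] := dfb_supported dP.
have : dfb (fun e => (forall i, i < m -> G i (ecns (e i) (fun j => e (m + j))))
                     /\ P e).
  apply: dfb_and => //; apply: dfb_alln => i.
  apply: dfb_ext (dfb_ren (fun k => if k is j.+1 then m + j else i) (hG i).1) => e.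
  by have -> : (fun k => e (if k is j.+1 then m + j else i)) =
              ecns (e i) (fun j => e (m + j)) by apply/funext => -[].
move=> /(dfb_exv m) h; eexists; first exact: h.
move=> e; rewrite hP.
have E v : (fun j => ecat m v (fun i : nat => c (e i)) (m + j)) = fun i => c (e i).
  by apply/funext => j; rewrite /ecat ltnNge leq_addr /= addKn.
split=> [Pe|[v [hv]]].
  exists (fun i => c (t i e)); split.
    by move=> i im; rewrite E; apply/(hG i).2; rewrite /ecat im.
  by apply: supP Pe => i im; rewrite /ecat im.
apply: supP => i im; have := hv i im; rewrite E => /(hG i).2 ->; exact: erefl.
Qed.

Lemma dI_lt i j : dI (fun e => e i < e j).
Proof.
by exists (fun e => lt (e i) (e j)) => [|e]; [exact: dfb_lt | rewrite clt].
Qed.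

Lemma dI_eventual (Q : nat -> Prop) : dI (fun e => Q (e 0)) ->
  ev Q \/ ev (fun n => ~ Q n).
Proof.
move=> [P dP hP].
have h n : Q n <-> P (fun=> c n) by rewrite -(hP (fun=> n)).
have [] := @chain_eventual _ _ _ _ _ chn (fun a => P (fun=> a)).
- exact: dfb_ren (fun=> 0) _ dP.
- by move=> [N hN]; left; exists N => n /hN/h.
- by move=> [N hN]; right; exists N => n /hN nP /h.
Qed.

(* If the slack [z - max {x | T x z}] were unbounded, the set of [z] at which
   the maximum increases would be neither finite nor cofinite. *)
Lemma cofinal_offset (T : nat -> nat -> Prop) : dI (fun e => T (e 0) (e 1)) ->
  (forall x z, T x z -> x <= z) ->
  (forall x x' z z', T x z -> x' <= x -> z <= z' -> T x' z') ->
  (forall x, exists z, T x z) -> exists k, forall x, T x (x + k).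
Proof.
move=> dT Tle Tmono Tcof.
pose J z := exists x, x <= z.+1 /\ (T x z.+1 /\ ~ T x z).
have dJ : dI (fun e => J (e 0)).
  have d1 : dI (fun e => exists x, x <= e 0 /\ (T x (e 0) /\ ~ T x (e 1))).
    apply: dI_bex; apply: dI_and.
      exact: (dI_subst (t := fun i e => e i) dT) tmI_var.
    apply: dI_not.
    apply: (dI_subst (t := fun i e => if i is 0 then e 0 else e 2) dT).
    by case=> [|i]; exact: tmI_var.
  apply: (dI_subst (t := fun i e => if i is 0 then (e 0).+1 else e 0) d1).
  by case=> [|i]; [apply: tmI_succ|]; exact: tmI_var.
have [|] := dI_eventual dJ; move=> [N hN]; last first.
  have [z hz] := Tcof N.+1.
  have : forall j, ~ T N.+1 (N + j).
    elim=> [|j IH]; first by move=> /Tle; lia.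
    rewrite addnS => h; apply: (hN (N + j)); first lia.
    by exists N.+1; split=> //; exact: Tle h.
  by move=> h; exfalso; apply: (h z); apply: (Tmono _ _ _ _ hz) => //; exact: leq_addl.
(* From [N] on the maximum increases with every step of [z], so the slack present at [maxn N z0]
   never grows. *)
have [z0 hz0] := Tcof 0; exists (maxn N z0); elim=> [|x IH].
  by apply: (Tmono _ _ _ _ hz0); lia.
have [|y [_ [Ty nTy]]] := hN (x + maxn N z0); first lia.
apply: (Tmono _ _ _ _ Ty); last by lia.
by rewrite ltnNge; apply/negP => yx; apply: nTy; exact: (Tmono _ _ _ _ IH).
Qed.

(** A tuple confined to an interval may be quantified, because the upper bound keeps its entries in
    [C]. A relation of any arity is thereby reduced to a binary one between the ends of the
    interval. *)
Lemma dI_box Q : dI Q -> exists m, supported m Q /\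
  dI (fun e => exists v, (forall i, i < m -> e 0 <= v i <= e 1) /\ Q v).
Proof.
move=> [P dP hP]; have [m /(_ m (leqnn m)) supP] := dfb_supported dP.
exists m; split=> [e e' ee'|]; first by rewrite !hP; apply: supP => i im; rewrite ee'.
have : dfb (fun e => (forall i, i < m ->
    D (e i) /\ (~ lt (e i) (e m) /\ ~ lt (e m.+1) (e i))) /\ P e).
  apply: dfb_and => //; apply: dfb_alln => i.
  apply: dfb_and; first exact: dfb_D.
  by apply: dfb_and; apply: dfb_not; exact: dfb_lt.
move=> /(dfb_exv m) h; eexists; first exact: h.
move=> e.
have E v i : i < m -> ecat m v (fun i => c (e i)) i = v i by rewrite /ecat => ->.
have E0 v : ecat m v (fun i => c (e i)) m = c (e 0) by rewrite /ecat ltnn subnn.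
have E1 v : ecat m v (fun i => c (e i)) m.+1 = c (e 1).
  by rewrite /ecat ltnNge leqnSn /= subSnn.
split=> [[v [hv /hP Pv]]|[v [hv Pv]]].
  exists (fun i => c (v i)); split; last by apply: supP Pv => i im; rewrite E.
  by move=> i im; rewrite E // E0 E1 !clt; have /andP[? ?] := hv i im; split=> //; lia.
have /choice[w hw] : forall i, exists w, i < m -> v i = c w /\ e 0 <= w <= e 1.
  move=> i; case: (ltnP i m) => im; last by exists 0.
  have := hv i im; rewrite E // E0 E1 => -[Dv [ge le]].
  have [w we vw] := below_c Dv le; exists w => _; split=> //.
  by rewrite we andbT leqNgt; apply/negP => /clt; rewrite -vw.
exists w; split=> [i /hw[]//|]; apply/hP; apply: supP Pv => i im.
by rewrite E //; have [] := hw i im.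
Qed.

(** Suppose [Q] and its shift disagree at tuples beyond every bound. By [cofinal_offset], with a
    fixed [k], every window [[x, x + k]] contains such a tuple. There are finitely many patterns of
    offsets from [x], and along each of them [Q] is a set in the single variable [x], eventually
    constant and hence eventually equal to its shift: a contradiction for large [x]. *)
Lemma shift_invariant Q : dI Q -> exists n, forall e, (forall i, n <= e i) ->
  Q e <-> Q (fun i => (e i).+1).
Proof.
move=> dQ.
have dQS : dI (fun e => Q (fun i => (e i).+1)).
  by apply: dI_subst (dQ) _ => i; apply: tmI_succ; exact: tmI_var.
pose Z e := ~ (Q e <-> Q (fun i => (e i).+1)).
have dZ : dI Z by apply: dI_not; apply: dI_iff.
have [m [supZ dbox]] := dI_box dZ.
(* The first conjunct gives [x <= z] also when [m = 0] and the condition on [v] is void. *)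
pose T x z := ~ (z < x) /\
  exists v : nat -> nat, (forall i, i < m -> x <= v i <= z) /\ Z v.
have [Tcof|] := pselect (forall x, exists z, T x z); last first.
  move=> /existsNP[n /forallNP nT]; exists n => e en; apply: contrapT => Ze.
  apply: (nT (maxn n (\max_(i < m) e i))); split; first lia.
  exists e; split=> // i im; rewrite en /= leq_max; apply/orP; right.
  exact: (@leq_bigmax _ (fun i : 'I_m => e i) (Ordinal im)).
have [||x x' z z'|//|k hk] := @cofinal_offset T.
- by apply: dI_and dbox; apply: dI_not; exact: dI_lt.
- by move=> x z []; lia.
- move=> [xz [v [hv Zv]]] xx' zz'; split; first lia.
  by exists v; split=> // i /hv; lia.
pose sh (o : {ffun 'I_m -> 'I_k.+1}) i : nat := if insub i is Some j then o j else 0.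
have : forall o, ev (fun x => ~ Z (fun i => x + sh o i)).
  move=> o.
  have dQo : dI (fun e => Q (fun i => e 0 + sh o i)).
    by apply: dI_subst (dQ) _ => i; apply: tmI_add; exact: tmI_var.
  case: (@dI_eventual (fun x => Q (fun i => x + sh o i)) dQo) => -[N hN];
    exists N => x Nx; apply; have h := hN _ Nx;
    have h' := hN x.+1 (leqW Nx); split=> //.
move=> /ev_fin[N hN]; have [_ [v [hv Zv]]] := hk N.
have lev (i : 'I_m) : v i - N < k.+1 by have := hv i (ltn_ord i); lia.
exfalso; apply: (hN N (leqnn N) [ffun i => Ordinal (lev i)]).
apply: supZ Zv => i im; rewrite /sh insubT /= ffunE /=.
by have := hv i im; lia.
Qed.

(** When [y] and all arguments exceed the threshold [n], the configuration is translated down until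
    its smallest entry equals [n]. If this entry is an argument, it becomes a constant and induction
    on the number of arguments applies. If it is [y], either an argument is close to it, or all
    arguments are beyond [n']: then shifting the arguments alone keeps the value [n], while shifting
    everything gives [n.+1], against functionality. *)
Lemma functional_near (s : seq nat) (Q : nat -> (nat -> nat) -> Prop) :
  dI (fun e => Q (e 0) (fun i => e i.+1)) ->
  (forall y x x', (forall i, i \in s -> x i = x' i) -> Q y x -> Q y x') ->
  (forall x y y', Q y x -> Q y' x -> y = y') ->
  exists k, forall x y, Q y x ->
    y <= k \/ exists i, i \in s /\ (y <= x i + k /\ x i <= y + k).
Proof.
have [r] := ubnP (size s); elim: r s Q => // r IH s Q sr dQ supQ funQ.
have [n hn] := shift_invariant dQ.
have [n' hn'] : exists n', forall x, (forall i, n' <= x i) ->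
    Q n x <-> Q n (fun i => (x i).+1).
  have dQn : dI (fun e => Q n e).
    apply: (dI_subst (t := fun i e => if i is j.+1 then e j else n) dQ).
    by case=> [|i]; [exact: tmI_const | exact: tmI_var].
  exact: shift_invariant dQn.
pose near k (s' : seq nat) y (x : nat -> nat) := y <= k \/
  exists i, i \in s' /\ (y <= x i + k /\ x i <= y + k).
have near_mono k k' s' y x : k <= k' -> near k s' y x -> near k' s' y x.
  move=> kk' [?|[i [? [? ?]]]]; first by left; lia.
  by right; exists i; split=> //; lia.
pose upd i a (x : nat -> nat) j := if j == i then a else x j.
(* The finitely many cases in which some argument has a value at most [n]; substituting this
   constant leaves a function of fewer arguments. *)
have [k1 hk1] : exists k, forall ia, ia \in [seq (i, a) | i <- s, a <- iota 0 n.+1] ->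
    forall x y, Q y x -> x ia.1 = ia.2 -> near k [seq j <- s | j != ia.1] y x.
  apply: exists_bound_seq.
    by move=> [i a] k k' kk' h x y Qy xi; apply: near_mono kk' (h x y Qy xi).
  move=> [i a] /allpairsP[[i' a'] [/= i's _ [-> ->]]] {i a}.
  have [||||k hk] := IH [seq j <- s | j != i'] (fun y x => Q y (upd i' a' x)).
  - have ps : size [seq j <- s | j == i'] > 0.
      by rewrite size_filter -has_count has_pred1.
    rewrite -ltnS; apply: leq_trans sr; rewrite ltnS !size_filter in ps *.
    by rewrite -(count_predC (pred1 i') s) -[ltnLHS]add0n ltn_add2r.
  - apply: (dI_subst (t := fun i e => if i is j.+1 then
      (if j == i' then a' else e j.+1) else e 0) dQ).
    by case=> [|i]; [|case: eqP => _; [exact: tmI_const|]]; exact: tmI_var.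
  - move=> y x x' xx'; apply: supQ => i si; rewrite /upd; case: eqP => // /eqP ii'.
    by apply: xx'; rewrite mem_filter ii'.
  - by move=> x y y'; exact: funQ.
  exists k => x y Qy xi; apply: hk; apply: supQ Qy => i _; rewrite /upd.
  by case: eqP => // ->.
exists (k1 + n + n') => x y Qy.
have [yn|ny] := leqP y n; first by left; lia.
have [[i [si xin]]|nx] := pselect (exists i, i \in s /\ x i <= n).
  have : (i, x i) \in [seq (i, a) | i <- s, a <- iota 0 n.+1].
    by apply/allpairsP; exists (i, x i); rewrite mem_iota.
  move=> /(hk1 (i, x i)) /(_ x y Qy erefl) [|[j [+ hj]]]; first by left; lia.
  by rewrite mem_filter => /andP[_ sj]; right; exists j; split=> //; lia.
have {}nx i : i \in s -> n < x i.
  by move=> si; rewrite ltnNge; apply/negP => xi; apply: nx; exists i.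
pose d := \big[minn/y]_(i <- s) x i - n.
have dmin i : i \in s -> \big[minn/y]_(i <- s) x i <= x i.
  elim: (s) => // a s' IHs; rewrite big_cons => /predU1P[->|/IHs]; lia.
have dy : \big[minn/y]_(i <- s) x i <= y.
  by elim: (s) => [|a s' IHs]; rewrite ?big_nil ?big_cons; lia.
have datt : \big[minn/y]_(i <- s) x i = y \/
    exists2 i, i \in s & \big[minn/y]_(i <- s) x i = x i.
  elim: (s) => [|a s' IHs]; first by left; rewrite big_nil.
  rewrite big_cons; case: (leqP (x a) (\big[minn/y]_(i <- s') x i)) => h.
    by right; exists a; rewrite ?mem_head.
  case: IHs => [->|[i si E]]; first by left.
  by right; exists i => //; rewrite in_cons si orbT.
have dn : n < \big[minn/y]_(i <- s) x i.
  by case: datt => [->//|[i si ->]]; exact: nx.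
(* [Q] ignores the entries outside [s]; the value [n + n'] keeps them above both thresholds of shift
   invariance. *)
pose x1 i := if i \in s then x i - d else n + n'.
have Q1 : Q (y - d) x1.
  have : forall j, j <= d -> Q (y - j) (fun i => if i \in s then x i - j else n + n').
    elim=> [|j IHj] jd.
      by rewrite subn0; apply: supQ Qy => i ->; rewrite subn0.
    apply/(hn (ecns (y - j.+1) (fun i => if i \in s then x i - j.+1 else n + n'))).
      case=> [|i] /=; first by lia.
      by case: ifP => [/dmin|]; lia.
    have -> /= : (y - j.+1).+1 = y - j by lia.
    apply: supQ (IHj (ltnW jd)) => i si; rewrite si; have := dmin i si; lia.
  exact.
have [dyn|[i si di]] := datt.
  (* The translated [y] equals [n]. If all arguments are beyond [n'], the value at their shift would
     be both [n] and [n.+1]. *)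
  have [hx1|] := pselect (forall i, i \in s -> n' <= x1 i).
    have E : y - d = n by lia.
    rewrite E in Q1.
    have /hn' Q2 : Q n x1 by [].
    exfalso; have/Q2 Q3 : forall i, n' <= x1 i.
      move=> i; have := hx1 i; rewrite /x1; case: ifP => _ h; last by lia.
      exact: h.
    have Q4 : Q n.+1 (fun i => (x1 i).+1).
      apply/(hn (ecns n x1)) => // -[|i] //=.
      by rewrite /x1; case: ifP => [/dmin|]; lia.
    by have := funQ _ _ _ Q3 Q4; lia.
  move=> /existsNP[i /not_implyP[si]]; rewrite /x1 si => /negP; rewrite -ltnNge => h.
  by right; exists i; split=> //; have := dmin i si; lia.
(* The argument [i] now has the value [n], so [k1] applies to the translated configuration, and
   translation preserves distances. *)
have /(hk1 (i, n)) : (i, n) \in [seq (i, a) | i <- s, a <- iota 0 n.+1].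
  by apply/allpairsP; exists (i, n); rewrite mem_iota ltnSn.
move=> /(_ _ _ Q1) [|h|[j [+]]].
- by rewrite /= /x1 si; lia.
- by right; exists i; split=> //; have := dmin i si; lia.
rewrite mem_filter => /andP[_ sj]; rewrite /x1 sj => h.
by right; exists j; split=> //; have := dmin j sj; lia.
Qed.

End Chain.

(** * Realizations of the limit type *)

Definition limit_point_of (L : language) (M : structure L) (c : nat -> M)
    (a : M) : Prop :=
  forall P : M -> Prop, dfb (fun e => P (e 0)) -> ev (fun n => P (c n)) -> P a.

Section Limit.
Variables (L : language) (M : structure L) (c : nat -> M).
Variables (D : set M) (lt : M -> M -> Prop).
Hypothesis chn : eventual_chain c D lt.

Let cD := chain_D chn.
Let clt := chain_lt chn.
Let lin := chain_linear chn.
Notation pM := (limit_point_of c).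
Notation isucc := (imm_succ D lt).

Lemma limit_D a : pM a -> D a.
Proof. by apply; [exact: dfb_D chn 0 | exists 0]. Qed.

Lemma limit_gt a n : pM a -> lt (c n) a.
Proof.
apply; last by exists n.+1 => k nk; apply/clt.
apply: dfb_ext (dfb_ex (P := fun a e => a = c n /\ lt a (e 0)) _).
  by move=> e; split=> [[a' [->]]//|h]; exists (c n).
by apply: dfb_and; [exact: dfb_c chn 0 n | exact: dfb_lt chn 0 1].
Qed.

Lemma limit_neq_c a n : pM a -> a <> c n.
Proof.
have [irr _ _] := lin; move=> pa an; apply: (irr _ (limit_D pa)).
by have := limit_gt n pa; rewrite -an.
Qed.

(** On [C] passing to a neighbour moves the index by one, so a property that holds eventually also
    holds eventually of the neighbours. *)
Lemma limit_succ a b : isucc a b -> pM a <-> pM b.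
Proof.
move=> ab; split=> pa P dP evP.
  suff : forall b', isucc a b' -> P b' by apply.
  apply: (pa (fun x => forall y, isucc x y -> P y)).
    apply: dfb_all; apply: dfb_imp; first exact: dfb_imm_succ chn 1 0.
    exact: dP.
  move: evP => [N hN]; exists N => n Nn y /(imm_succ_inj_r chn)/(_ (imm_succ_c chn n)).
  by move=> ->; apply: hN; exact: leqW.
suff : forall b', isucc b' b -> P b' by apply.
apply: (pa (fun x => forall y, isucc y x -> P y)).
  apply: dfb_all; apply: dfb_imp; first exact: dfb_imm_succ chn 0 1.
  exact: dP.
move: evP => [N hN]; exists N.+1 => -[//|n] Nn y.
by move=> /(imm_succ_inj_l chn)/(_ (imm_succ_c chn n)) ->; exact: hN.
Qed.

(** * Transfer from [C] to the realizations of the limit type *)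

Definition in_closure (a : M) : Prop := pM a \/ exists n, a = c n.

(** The bound is the largest among the entries that realize the limit type; the entries in [C] lie
    below it anyway. *)
Lemma closure_bound (e : nat -> M) m : (forall i, in_closure (e i)) ->
  (forall i, i < m -> exists n, e i = c n) \/
  exists w, pM w /\ forall i, i < m -> D (e i) /\ ~ lt w (e i).
Proof.
have [irr tr tot] := lin => he; elim: m => [|m [IH|[w [pw hw]]]]; first by left.
  have [pm|[n em]] := he m.
    right; exists (e m); split=> // i; rewrite ltnS leq_eqVlt => /predU1P[->|im].
      by split; [exact: limit_D | apply: irr; exact: limit_D].
    have [n ->] := IH i im; split=> // h; apply: (irr (c n)) => //.
    exact: (tr _ _ _ _ (limit_D pm) _ (limit_gt n pm) h).
  left => i; rewrite ltnS leq_eqVlt => /predU1P[->|im]; last exact: IH.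
  by exists n.
right.
have Dm : D (e m) by case: (he m) => [/limit_D//|[n ->]].
have Dw := limit_D pw.
case: (tot (e m) w Dm Dw) => h.
- exists w; split=> // i; rewrite ltnS leq_eqVlt => /predU1P[->|im]; last exact: hw.
  by split=> // h'; apply: (irr w) => //; exact: (tr _ _ _ _ _ _ h' h).
- exists w; split=> // i; rewrite ltnS leq_eqVlt => /predU1P[->|im]; last exact: hw.
  by split=> //; rewrite h; exact: irr.
exists (e m); split; last first.
  move=> i; rewrite ltnS leq_eqVlt => /predU1P[->|im]; first by split=> //; exact: irr.
  have [Di hi] := hw i im; split=> // h'; apply: hi; exact: (tr _ _ _ _ _ _ h h').
case: (he m) => // -[n em]; exfalso; apply: (irr w) => //.
by apply: (tr _ _ _ _ _ _ h) => //; rewrite em; exact: limit_gt.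
Qed.

(** Quantifying over all tuples below [w] turns the claim into a property of [w] alone. It holds for
    every [w = c n], since tuples below [c n] lie in [C], and so it passes to limit points. *)
Lemma closure_transfer (P : (nat -> M) -> Prop) : dfb P ->
  (forall f : nat -> nat, P (fun i => c (f i))) ->
  forall e, (forall i, in_closure (e i)) -> P e.
Proof.
move=> dP Pc e he; have [m /(_ m (leqnn m)) supP] := dfb_supported dP.
have {}Pc v : (forall i, i < m -> exists n, v i = c n) -> P v.
  move=> hv.
  have /choice[f hf] : forall i, exists n, i < m -> v i = c n.
    by move=> i; case: (ltnP i m) => [/hv[n ->]|_]; [exists n | exists 0].
  by apply: supP (Pc f) => i im; rewrite hf.
have [|[w [pw hw]]] := closure_bound m he; first exact: Pc.
suff : forall v, (forall i, i < m -> D (v i) /\ ~ lt w (v i)) -> P v by exact.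
apply: (pw (fun w => forall v, (forall i, i < m -> D (v i) /\ ~ lt w (v i)) -> P v)).
  have : dfb (fun e => (forall i, i < m -> D (e i) /\ ~ lt (e m) (e i)) /\ ~ P e).
    apply: dfb_and; last exact: dfb_not.
    apply: dfb_alln => i; apply: dfb_and; first exact: dfb_D chn i.
    by apply: dfb_not; exact: dfb_lt chn m i.
  move=> /(dfb_exv m)/dfb_not; apply: dfb_ext => e'.
  have E v i : i < m -> ecat m v e' i = v i by rewrite /ecat => ->.
  have E0 v : ecat m v e' m = e' 0 by rewrite /ecat ltnn subnn.
  split=> [h v hv|h [v [hv nP]]].
    apply: contrapT => nP; apply: h; exists v; split.
      by move=> i im; rewrite E // E0; exact: hv.
    by move=> Pv; apply: nP; apply: supP Pv => i im; rewrite E.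
  apply: nP; apply: (supP v); first by move=> i im; rewrite E.
  by apply: h => i im; have := hv i im; rewrite E // E0.
exists 0 => n _ v hv; apply: Pc => i /hv[Di /(below_c chn Di)[k _ ->]].
by exists k.
Qed.

(** Distance at most [k] along immediate neighbours. It is definable for each fixed [k] only, so
    bounds on distances must be uniform before they can be transferred. *)
Fixpoint near k (a b : M) : Prop :=
  if k is k'.+1 then near k' a b \/
    exists a', (isucc a a' \/ isucc a' a) /\ near k' a' b
  else a = b.

Lemma dfb_near k i j : dfb (fun e : nat -> M => near k (e i) (e j)).
Proof.
elim: k i j => [|k IH] i j /=; first exact: dfb_eq.
apply: dfb_or => //; apply: dfb_ex; apply: dfb_and; last exact: IH 0 j.+1.
by apply: dfb_or; [exact: dfb_imm_succ chn i.+1 0|exact: dfb_imm_succ chn 0 i.+1].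
Qed.

Lemma near_c k i j : i <= j + k -> j <= i + k -> near k (c i) (c j).
Proof.
elim: k i j => [|k IH] i j ij ji /=; first by congr c; lia.
have [ltij|ltji|->] := ltngtP i j; last by left; apply: IH; lia.
  right; exists (c i.+1); split; first by left; exact: imm_succ_c.
  by apply: IH; lia.
case: i ij ji ltji => // i ij ji ltji.
right; exists (c i); split; first by right; exact: imm_succ_c.
by apply: IH; lia.
Qed.

Definition is_min (X : M -> (nat -> M) -> Prop) b (e : nat -> M) : Prop :=
  (D b /\ X b e) /\ forall z, D z /\ lt z b -> ~ X z e.

Lemma dfb_is_min (X : M -> (nat -> M) -> Prop) :
  dfb (fun e => X (e 0) (fun i => e i.+1)) ->
  dfb (fun e => is_min X (e 0) (fun i => e i.+1)).
Proof.
move=> dX; apply: dfb_and; first by apply: dfb_and => //; exact: dfb_D chn 0.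
apply: dfb_all; apply: dfb_imp.
  by apply: dfb_and; [exact: dfb_D chn 0 | exact: dfb_lt chn 0 1].
apply: dfb_not.
exact: (dfb_ren (fun i => if i is j.+1 then j.+2 else 0) dX).
Qed.

(** On [C] this is the least number principle for indices; it is transferred with [b] as coordinate
    0. *)
Lemma closure_min (X : M -> (nat -> M) -> Prop) b (e : nat -> M) :
  dfb (fun e => X (e 0) (fun i => e i.+1)) ->
  (forall i, in_closure (e i)) -> in_closure b -> X b e ->
  exists b', is_min X b' e.
Proof.
move=> dX he hb.
apply: (@closure_transfer (fun e => X (e 0) (fun i => e i.+1) ->
  exists b', is_min X b' (fun i => e i.+1)) _ _ (ecns b e)); last by case.
  apply: dfb_imp => //; apply: dfb_ex.
  exact: (dfb_ren (fun i => if i is j.+1 then j.+2 else 0) (dfb_is_min dX)).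
move=> f; set x := fun i => c (f i.+1).
elim/ltn_ind: (f 0) => n IH Xn.
have [[k [kn Xk]]|nk] := pselect (exists k, k < n /\ X (c k) x); first exact: IH kn Xk.
exists (c n); split=> // z [Dz zn] Xz; apply: nk.
have [k zk] := chain_initial chn Dz zn; exists k; split; last by rewrite -zk.
by move: zn; rewrite zk => /clt.
Qed.

(** [k] is found on [C], where the minimum is a function of the parameters, and only the resulting
    implication is transferred. The alternative of a bounded minimum vanishes, because a realization
    of the limit type exceeds [c k]. *)
Lemma min_near (X : M -> (nat -> M) -> Prop) :
  dfb (fun e => X (e 0) (fun i => e i.+1)) ->
  exists k, forall b (e : nat -> M), (forall i, in_closure (e i)) -> pM b ->
    is_min X b e -> exists i, near k b (e i).
Proof.
move=> dX; have dm := dfb_is_min dX.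
(* Coordinate 0 is the minimum itself, so [m.+1] coordinates leave [m] parameters. *)
have [m /(_ m.+1 (leqnSn m)) supm] := dfb_supported dm.
have [||x y y'|k hk] := @functional_near _ _ _ _ _ chn (iota 0 m)
   (fun y x => is_min X (c y) (fun i => c (x i))).
- by eexists; [exact: dm|].
- move=> y x x' xx'.
  apply: (supm (ecns (c y) (fun i => c (x i))) (ecns (c y) (fun i => c (x' i)))).
  by case=> //= i im; rewrite xx' // mem_iota.
- move=> [[_ Xy] hy] [[_ Xy'] hy']; case: (ltngtP y y') => // /clt h; exfalso.
    exact: (hy' (c y)).
  exact: (hy (c y')).
exists k => b e he pb mb.
have hbe i : in_closure (ecns b e i) by case: i => [|i]; [left | exact: he].
have := @closure_transfer (fun e => is_min X (e 0) (fun i => e i.+1) /\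
  ~ (exists a, a = c k /\ ~ lt a (e 0)) ->
  exists i, i < m /\ near k (e 0) (e i.+1)) _ _ (ecns b e) hbe.
case=> [||//|i [_ h]]; last by exists i.
- apply: dfb_imp; last by apply: dfb_exn => i; exact: dfb_near.
  apply: dfb_and => //; apply: dfb_not; apply: dfb_ex; apply: dfb_and.
    exact: dfb_c chn 0 k.
  by apply: dfb_not; exact: dfb_lt chn 0 1.
- move=> f [hmin hlt].
  have [fk|[i [+ [h1 h2]]]] := hk _ _ hmin.
    exfalso; apply: hlt; exists (c k); split=> // /clt; lia.
  by rewrite mem_iota => im; exists i; split=> //; exact: near_c.
split=> // -[a [-> h]]; apply: h; exact: limit_gt.
Qed.

(* A consistent condition never forces a new realization: the values it allows
   would have a least element, definable from the old realizations and hence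
   at finite distance from one of them. *)
Lemma omit_step (I : pred nat) (e0 : nat -> M) :
  (forall i, I i -> in_closure (e0 i)) ->
  (forall i a, I i -> pM a -> isucc (e0 i) a \/ isucc a (e0 i) ->
     exists2 j, I j & a = e0 j) ->
  forall X j, dfb X -> (exists2 e, X e & forall i, I i -> e i = e0 i) ->
  exists e, [/\ X e, forall i, I i -> e i = e0 i &
                pM (e j) -> exists2 i, I i & e j = e0 i].
Proof.
move=> he0 clI X j dX [e Xe ee0]; apply: contrapT => /forallNP hX.
have {}hX e' : X e' -> (forall i, I i -> e' i = e0 i) ->
    pM (e' j) /\ forall i, I i -> e' j <> e0 i.
  move=> Xe' ee'; split=> [|i Ii eq_i]; [apply: contrapT => np|];
    by apply: (hX e'); split=> // ?; exists i.
(* [c 0] fills the places without a parameter: it is in the closure, and no realization of the limit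
   type is at finite distance from it. *)
pose e1 i := if I i then e0 i else c 0.
have he1 i : in_closure (e1 i).
  by rewrite /e1; case: ifP => [/he0//|_]; right; exists 0.
pose Y y (x : nat -> M) := exists v, [/\ forall i, I i -> v i = x i, v j = y & X v].
have dY : dfb (fun e => Y (e 0) (fun i => e i.+1)) by exact: dfb_proj.
have Ye1 b : Y b e1 -> pM b /\ forall i, I i -> b <> e0 i.
  move=> [v [h1 <- Xv]]; apply: hX => // i Ii.
  by rewrite h1 // /e1 Ii.
have Yj : Y (e j) e1 by exists e; split=> // i Ii; rewrite ee0 // /e1 Ii.
have [b minb] := closure_min dY he1 (or_introl (Ye1 _ Yj).1) Yj.
have [k hk] := min_near dY; have [[_ /Ye1[pb nb]] _] := minb.
have [i] := hk b e1 he1 pb minb.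
(* A path of neighbours starting at a realization consists of realizations; followed backwards from
   its end, it stays among the prescribed ones by [clI]. *)
suff nearI : forall a, pM a -> near k a (e1 i) -> exists2 i, I i & a = e0 i.
  by move=> /(nearI b pb)[i' Ii']; exact: nb.
elim: k {hk} => [|k IH] a pa /=.
  rewrite /e1; case: ifP => [Ii ->|_ ac]; first by exists i.
  by case: (limit_neq_c pa ac).
case=> [|[a' [aa' na']]]; first exact: IH.
have pa' : pM a' by case: aa' => /limit_succ h; apply/h.
have [i' Ii' a'i] := IH a' pa' na'.
by apply: (clI i' a) => //; rewrite -a'i; tauto.
Qed.

End Limit.

(** * Countability of the set of formulas *)

Section FormulaCode.
Variables (L : language) (fc : Defs.fsym L -> nat) (rc : rsym L -> nat).
Hypotheses (fc_inj : injective fc) (rc_inj : injective rc).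
Local Notation Tree := (GenTree.tree nat).

Fixpoint tcode n (t : term L n) : Tree :=
  match t with
  | tvar i => GenTree.Leaf (i : nat)
  | tapp f ts =>
      GenTree.Node (fc f) [seq tcode (ts i) | i <- enum 'I_(fsym_arity f)]
  end.

Lemma tcode_inj n : injective (@tcode n).
Proof.
elim=> [i|f ts IH] [j|g us] //= [].
  by move/val_inj->.
move=> /fc_inj fg; case: g / fg us => us /eq_in_map h; congr tapp.
by apply/funext => i; apply: IH; apply: h; rewrite mem_enum.
Qed.

Fixpoint fcode n (phi : formula L n) : Tree :=
  match phi with
  | fbot _ => GenTree.Node 0 [::]
  | feq _ t u => GenTree.Node 1 [:: tcode t; tcode u]
  | Defs.frel _ r ts => GenTree.Node 2
      (GenTree.Leaf (rc r) :: [seq tcode (ts i) | i <- enum 'I_(rsym_arity r)])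
  | fimp _ phi psi => GenTree.Node 3 [:: fcode phi; fcode psi]
  | fall _ phi => GenTree.Node 4 [:: fcode phi]
  end.

Lemma fcode_inj n : injective (@fcode n).
Proof.
move=> phi; elim: phi => {n} [n|n t u|n r ts|n a IHa b IHb|n a IHa] psi.
- by destruct psi.
- destruct psi as [| n t' u' | | |] => //= -[/tcode_inj-> /tcode_inj->] //.
- destruct psi as [| | n r' ts' | |] => //= -[/rc_inj rr'].
  case: r' / rr' ts' => ts' /eq_in_map h; congr Defs.frel.
  by apply/funext => i; apply: tcode_inj; apply: h; rewrite mem_enum.
- by destruct psi as [| | | n a' b' |] => //= -[/IHa-> /IHb->].
- by destruct psi as [| | | | n a'] => //= -[/IHa->].
Qed.

End FormulaCode.

Lemma countable_type_inj (X : Type) : countable [set: X] ->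
  exists f : X -> nat, injective f.
Proof. by move=> /countable_injP[f hf]; exists f => x y; apply: hf; rewrite inE. Qed.

Lemma formula_code (L : language) : countable_language L ->
  exists F : {n & formula L n} -> nat, injective F.
Proof.
move=> [/countable_type_inj[fc hf] /countable_type_inj[rc hr]].
exists (fun x => pickle (projT1 x, fcode fc rc (projT2 x))) => -[n phi] [m psi].
move=> /(pcan_inj pickleK)/= [nm]; case: m / nm psi => psi.
by move=> /(fcode_inj hf hr)->.
Qed.

(** This list is the agenda of the constructions below. A number that codes no formula gives the
    empty relation. *)
Lemma dfb_enum (L : language) (M : structure L) : countable_language L ->
  exists F : nat -> (nat -> M) -> Prop,
    (forall n, dfb (F n)) /\ forall P, dfb P -> exists n, F n = P.
Proof.
move=> /formula_code[code code_inj].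
exists (fun k (e : nat -> M) => exists x,
  code x = k /\ sat M (projT2 x) (fun i => e i)).
split=> [k|P [n [phi h]]].
  have [[x cx]|nx] := pselect (exists x, code x = k); last first.
    apply: dfb_ext (dfb_const M False) => e.
    by split=> // -[x [cx _]]; apply: nx; exists x.
  exists (projT1 x), (projT2 x) => e; split=> [[y [+ s]]|s]; last by exists x.
  by rewrite -cx => /code_inj <-.
exists (code (existT _ n phi)); apply/funext => e; apply/propext; rewrite h.
by split=> [[y [/code_inj-> //]]|s]; exists (existT _ n phi).
Qed.

(** * Realizing countably many conditions *)

Lemma exists_bound_finite (T : Type) (A : set T) (Q : T -> nat -> Prop) :
  finite_set A -> (forall x k k', k <= k' -> Q x k -> Q x k') ->
  (forall x, A x -> exists k, Q x k) -> exists k, forall x, A x -> Q x k.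
Proof.
move=> /finite_setP[n /card_set_bijP[f [fA finj _]]] monoQ hQ.
have [||k hk] := @exists_bound_seq _ (iota 0 n)
    (fun i k => forall x, A x -> f x = i -> Q x k).
- by move=> i k k' kk' h x Ax fx; apply: monoQ kk' (h x Ax fx).
- move=> i _; have [[x [Ax fx]]|nx] := pselect (exists x, A x /\ f x = i).
    have [k hk] := hQ x Ax; exists k => y Ay fy.
    by have -> // : y = x by apply: finj; rewrite ?inE// fx.
  by exists 0 => x Ax fx; case: nx; exists x.
by exists k => x Ax; apply: (hk (f x)) => //; rewrite mem_iota /= add0n; exact: fA.
Qed.

Section Saturation.
Variables (L : language) (M : structure L).
Hypothesis satM : aleph1_saturated M.

(** As the conditions decrease, any finitely many follow from a single one; the range of [e0] is the
    countable parameter set. *)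
Lemma saturated_point (X : nat -> (nat -> M) -> Prop) (e0 : nat -> M) :
  (forall s, dfb (X s)) -> (forall s t e, s <= t -> X t e -> X s e) ->
  (forall s, exists y, X s (ecns y e0)) -> exists y, forall s, X s (ecns y e0).
Proof.
move=> dX decX consX.
have /choice[pf hpf] : forall s, exists pf : pformula M,
    (forall i, range e0 (pf_par pf i)) /\ forall y, psat pf y <-> X s (ecns y e0).
  move=> s; have [n /(_ n.+1 (leqnSn n))[phi hphi]] := dfb_widen (dX s).
  exists (PFormula phi (fun i => e0 i)); split=> [i|y]; first by exists (i : nat).
  rewrite hphi /psat /=; have -> // : scons y (fun i : 'I_n => e0 i) =
     fun i : 'I_n.+1 => ecns y e0 i by apply/funext => i; rewrite scons_ecns.
have [|_ [s _ <-] i||y hy] := satM (A := range e0) (S := range pf).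
- exact: card_image_le.
- exact: (hpf s).1.
- move=> S0 finS0 S0pf.
  have [||N hN] := @exists_bound_finite _ S0
      (fun phi k => forall y, X k (ecns y e0) -> psat phi y) finS0.
  + by move=> phi k k' kk' h y /(decX _ _ _ kk')/h.
  + by move=> phi /S0pf[k _ <-]; exists k => y /(hpf k).2.
  by have [y hy] := consX N; exists y => phi S0phi; apply: hN.
by exists y => s; apply/(hpf s).2; apply: hy; exists s.
Qed.

Definition agree (I : pred nat) (e e' : nat -> M) : Prop :=
  forall i, I i -> e i = e' i.

(** Coordinates are fixed one after the other, keeping each [X s] satisfiable together with the
    coordinates fixed so far. The limit satisfies [X s], which depends on finitely many coordinates
    only. *)
Lemma saturated_env (X : nat -> (nat -> M) -> Prop) (I : pred nat) (e0 : nat -> M) :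
  (forall s, dfb (X s)) -> (forall s t e, s <= t -> X t e -> X s e) ->
  (forall s, exists2 e, X s e & agree I e e0) ->
  exists2 e, (forall s, X s e) & agree I e e0.
Proof.
move=> dX decX cons0.
pose J n i := I i || (i < n).
pose Inv n e := forall s, exists2 e', X s e' & agree (J n) e' e.
have step n e : Inv n e -> exists e', Inv n.+1 e' /\ agree (J n) e' e.
  move=> inv; have [||s|y hy] := @saturated_point (fun s e =>
    exists v, [/\ forall i, J n i -> v i = e i.+1, v n = e 0 & X s v]) e.
  - by move=> s; exact: dfb_proj.
  - by move=> s t e' st [v [h1 h2 h3]]; exists v; split=> //; exact: decX h3.
  - by have [e' Xe' ee'] := inv s; exists (e' n), e'.
  exists (fun i => if i == n then y else e i); split.
    move=> s; have [v [h1 h2 h3]] := hy s; exists v => // i.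
    case: eqP => [->//|/eqP ni].
    by rewrite /J ltnS leq_eqVlt (negPf ni) /= => /h1.
  (* If [n] is itself in [I], the projected condition already forces the new value to be the
     prescribed one. *)
  move=> i; case: eqP => // ->; rewrite /J ltnn orbF => In.
  have [v [h1 h2 _]] := hy 0; rewrite -[y]h2 h1 //.
  by rewrite /J In.
have inv0 : Inv 0 e0.
  move=> s; have [e Xe ee0] := cons0 s; exists e => // i.
  by rewrite /J orbF; exact: ee0.
pose E := fix E n : {e | Inv n e} := if n is n'.+1 return {e | Inv n e} then
    let w := cid (step n' _ (svalP (E n'))) in exist _ (sval w) (svalP w).1
  else exist _ e0 inv0.
have ES n : agree (J n) (sval (E n.+1)) (sval (E n)).
  by move=> /=; case: cid => e' [] /=.
have EE n k : agree (J n) (sval (E (n + k))) (sval (E n)).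
  elim: k => [|k IH] i Ji; first by rewrite addn0.
  rewrite addnS ES ?IH //; move: Ji; rewrite /J => /orP[->//|h]; apply/orP; right.
  exact: leq_trans h (leq_addr _ _).
(* Coordinate [i] is final from stage [i.+1] on. *)
exists (fun i => sval (E i.+1) i); last first.
  move=> i Ii; rewrite (EE 0 i.+1) //=.
  by rewrite /J Ii.
move=> s; have [m /(_ m (leqnn m)) sup] := dfb_supported (dX s).
have [e Xe ee] := svalP (E m) s; apply: sup Xe => i im.
rewrite ee; last by rewrite /J im orbT.
rewrite -(subnKC im) EE // /J ltnSn orbT //.
Qed.

End Saturation.

(** * Elementary substructures from environments *)

Lemma dfb_sat (L : language) (M : structure L) n (phi : formula L n)
  (r : 'I_n -> nat) : dfb (fun e : nat -> M => sat M phi (fun i => e (r i))).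
Proof.
have h : dfb (fun e : nat -> M => sat M phi (fun i => e i)) by exists n, phi.
apply: dfb_ext (dfb_ren (fun k => if insub k is Some i then r i else 0) h) => e.
have -> // : (fun i : 'I_n => e (if insub (i : nat) is Some i then r i else 0)) =
  fun i => e (r i) by apply/funext => i; rewrite valK.
Qed.

Lemma tarski_vaught (L : language) (M : structure L) (e : nat -> M) :
  (forall P, dfb P -> exists w, forall y, P (ecns y e) -> P (ecns (e w) e)) ->
  exists N : elementary_substructure M, es_set N = range e.
Proof.
move=> tv.
have cl : fun_closed (range e).
  move=> f v hv; have /choice[r hr] : forall i, exists k, v i = e k.
    by move=> i; have [k _ <-] := hv i; exists k.
  (* Closure under [f] is the instance of the test for the formula [x_0 = f(x_1, ...)]. *)
  have := @dfb_sat L M _ (feq (tvar L ord0) (tapp (fun i => tvar L (lift ord0 i))))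
    (scons 0 (fun i : 'I_(fsym_arity f) => (r i).+1)) => /tv[w].
  have E y : (fun i => ecns y e (scons 0 (fun i : 'I_(fsym_arity f) => (r i).+1)
      (lift ord0 i))) = v.
    by apply/funext => i; rewrite /scons liftK hr.
  move=> /(_ (fun_of M f v)) /=; rewrite !E /scons !unlift_none /= => h.
  by exists w => //; exact: h.
have ne : range e !=set0 by exists (e 0), 0.
suff el : forall n (phi : formula L n) (v : 'I_n -> substructure ne cl),
    sat (substructure ne cl) phi v <-> sat M phi (fun i => sval (v i)).
  by exists (ElementarySubstructure el).
have evalE n (t : term L n) (v : 'I_n -> substructure ne cl) :
    sval (teval v t) = teval (fun i => sval (v i)) t.
  elim: t => //= f ts IH; congr fun_of; apply/funext => i; exact: IH.
move=> n phi; elim: phi => {n} [n|n t u|n r ts|n a IHa b IHb|n a IHa] v //=.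
- split=> [/(congr1 sval)|h]; first by rewrite !evalE.
  by apply: eq_sig_hprop => [x|]; [exact: Prop_irrelevance | rewrite /= !evalE].
- by have -> // : (fun i => sval (teval v (ts i))) =
    fun i => teval (fun i => sval (v i)) (ts i) by apply/funext => i; rewrite evalE.
- by rewrite (propext (IHa v)) (propext (IHb v)).
have E (x : substructure ne cl) :
    (fun i => sval (scons x v i)) = scons (sval x) (fun i => sval (v i)).
  by apply/funext => i; rewrite /scons; case: unliftP.
split=> h x; last by apply/IHa; rewrite E; exact: h.
apply: contrapT => nx.
have /choice[r hr] : forall i, exists k, sval (v i) = e k.
  by move=> i; have [k _ <-] := svalP (v i); exists k.
have /dfb_not/tv[w] := @dfb_sat L M _ a (scons 0 (fun i : 'I_n => (r i).+1)).
have Es y : (fun i => ecns y e (scons 0 (fun i : 'I_n => (r i).+1) i)) =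
    scons y (fun i => sval (v i)).
  by apply/funext => i; rewrite /scons; case: unliftP => //= j _; rewrite hr.
move=> /(_ x); rewrite !Es => /(_ nx); apply.
have := h (exist _ (e w) (imageT e w)); rewrite IHa E; exact.
Qed.

(** * Models with prescribed realizations of the limit type *)

Definition succ_in (X : Type) (R : X -> X -> Prop) (x y : X) : Prop :=
  R x y /\ forall z, ~ (R x z /\ R z y).

(* The position of [i] among [0, ..., s - 1] in the order [R]: it is strictly
   monotone and maps immediate successors to successors. *)
Definition rank (R : nat -> nat -> Prop) s i :=
  count (fun k => `[< R k i >]) (iota 0 s).

Section Models.
Variables (L : language) (M : structure L) (c : nat -> M).
Variables (D : set M) (lt : M -> M -> Prop).
Hypothesis chn : eventual_chain c D lt.
Hypothesis cL : countable_language L.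
Hypothesis satM : aleph1_saturated M.
Notation pM := (limit_point_of c).
Notation isucc := (imm_succ D lt).

(** Immediate successors in [M] are demanded besides the order, so that the image can be closed
    under neighbours taken in [M]. Finitely many requirements are met inside [C], by consecutive
    elements placed beyond the thresholds of the formulas involved. *)
Lemma embed_order (U : nat -> Prop) (R : nat -> nat -> Prop) :
  (forall i, ~ R i i) -> (forall i j k, R i j -> R j k -> R i k) ->
  (forall i j, U i -> U j -> [\/ R i j, i = j | R j i]) ->
  (forall i j, R i j -> U i /\ U j) ->
  exists e : nat -> M, [/\ forall i, U i -> pM (e i),
    forall i j, R i j -> lt (e i) (e j) &
    forall i j, succ_in R i j -> isucc (e i) (e j)].
Proof.
move=> irr tr tot RU; have [F [dF surjF]] := dfb_enum M cL.
pose evF t := ev (fun n => F t (fun=> c n)).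
pose X s (e : nat -> M) := forall i, i < s ->
  (forall t, t < s -> evF t -> F t (fun=> e i)) /\
  (forall j, j < s -> (R i j -> lt (e i) (e j)) /\
                      (succ_in R i j -> isucc (e i) (e j))).
have [||s|e Xe _] := @saturated_env L M satM X pred0 (fun=> c 0).
- move=> s; apply: dfb_alln => i; apply: dfb_and; apply: dfb_alln => j.
    apply: dfb_imp; first exact: dfb_const.
    exact: (dfb_ren (fun=> i) (dF j)).
  apply: dfb_and; (apply: dfb_imp; first exact: dfb_const).
    exact: dfb_lt chn i j.
  exact: dfb_imm_succ chn i j.
- move=> s t e st Xe i si; have [h1 h2] := Xe i (leq_trans si st).
  by split=> j sj; [apply: h1 | apply: h2]; exact: leq_trans sj st.
- have [N hN] : ev (fun n => forall t : 'I_s, evF t -> F t (fun=> c n)).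
    apply: ev_fin => t; have [[N hN]|nev] := pselect (evF t); last by exists 0.
    by exists N => n Nn _; exact: hN.
  exists (fun i => c (N + rank R s i)); last by move=> i.
  have sub i j : R i j -> forall k, R k i -> R k j by move=> ij k ki; exact: tr ij.
  move=> i si; split=> [t ts|j sj].
    exact: (hN _ (leq_addr _ _) (Ordinal ts)).
  (* Counting [i] together with the elements below it adds one to its rank; monotonicity and the
     successor property both compare with this count. *)
  have rankS : count (predU (fun k => `[< R k i >]) (pred1 i)) (iota 0 s) =
      (rank R s i).+1.
    have := count_predUI (fun k => `[< R k i >]) (pred1 i) (iota 0 s).
    rewrite (count_uniq_mem _ (iota_uniq 0 s)) mem_iota /= add0n si addn1.
    rewrite (@eq_count _ (predI _ _) pred0) ?count_pred0 ?addn0 // => k /=.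
    by apply/negP => /andP[/asboolP + /eqP ki]; rewrite ki; exact: irr.
  split=> [ij|[ij hij]].
    apply/(chain_lt chn); rewrite ltn_add2l -rankS; apply: sub_count => k /=.
    by move=> /orP[/asboolP ki|/eqP->]; apply/asboolP => //; exact: sub ki.
  suff -> : N + rank R s j = (N + rank R s i).+1 by exact: imm_succ_c.
  rewrite -addnS -rankS; congr (_ + _); apply: eq_count => k /=.
  have [Ui Uj] := RU _ _ ij.
  apply/asboolP/orP => [kj|[/asboolP ki|/eqP->//]]; last exact: sub ki.
  have [ki|->|ik] := tot k i (RU _ _ kj).1 Ui; [by left; apply/asboolP | by right|].
  by case: (hij k).
exists e; split=> [i Ui P dP evP|i j|i j].
- have [t Ft] := surjF _ dP.
  have := (Xe (i + t).+1 i _).1 t _; rewrite /evF Ft; apply=> //; lia.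
- by apply: ((Xe (i + j).+1 i _).2 j _).1; lia.
- by apply: ((Xe (i + j).+1 i _).2 j _).2; lia.
Qed.

(** Two tasks in one stage: [P] receives a Henkin witness, and coordinate [j] is either identified
    with a prescribed one or made to violate a formula of the limit type. [omit_step] shows that one
    of these decisions is consistent. *)
Lemma henkin_step (I : pred nat) (e0 : nat -> M) :
  (forall n, exists w, n <= w /\ ~~ I w) ->
  (forall i, I i -> in_closure c (e0 i)) ->
  (forall i a, I i -> pM a -> isucc (e0 i) a \/ isucc a (e0 i) ->
     exists2 j, I j & a = e0 j) ->
  forall P j (X : (nat -> M) -> Prop), dfb P -> dfb X ->
    (exists2 e, X e & agree I e e0) ->
  exists X' : (nat -> M) -> Prop, [/\ dfb X', exists2 e, X' e & agree I e e0,
    forall e, X' e -> X e,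
    forall e, X' e -> exists w, forall y, P (ecns y e) -> P (ecns (e w) e) &
    forall e, agree I e e0 -> X' e -> pM (e j) -> exists2 i, I i & e j = e0 i].
Proof.
move=> fresh he0 clI P j X dP dX [e Xe ee0].
have [m hm] := dfb_supported dX; have [m' hm'] := dfb_supported dP.
(* [w] is outside [I] and beyond both supports, so the value there can be changed freely. *)
have [w [mw Iw]] := fresh (m + m').
have supX := hm w ltac:(lia); have supP := hm' w ltac:(lia).
pose X1 e := X e /\ forall y, P (ecns y e) -> P (ecns (e w) e).
have dX1 : dfb X1.
  apply: dfb_and => //; apply: dfb_all; apply: dfb_imp.
    apply: dfb_ext dP => e'.
    by have -> : ecns (e' 0) (fun i => e' i.+1) = e' by apply/funext => -[].
  apply: dfb_ext (dfb_ren (fun i => if i is k.+1 then k.+1 else w.+1) dP) => e'.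
  have -> // : (fun i => e' (if i is k.+1 then k.+1 else w.+1)) =
    ecns (e' w.+1) (fun i => e' i.+1) by apply/funext => -[].
have X1e : exists2 e, X1 e & agree I e e0.
  have [y hy] : exists y, forall z, P (ecns z e) -> P (ecns y e).
    have [[y Py]|nP] := pselect (exists y, P (ecns y e)); first by exists y.
    by exists (e 0) => z Pz; case: nP; exists z.
  pose e' i := if i == w then y else e i.
  have ee' i : i < w -> e' i = e i by rewrite /e'; case: eqP => // ->; rewrite ltnn.
  exists e'; last first.
    move=> i Ii; rewrite /e'; case: eqP => [iw|_]; last exact: ee0.
    by rewrite -iw Ii in Iw.
  split; first by apply: supX Xe => i /ee'.
  have sP z : P (ecns z e') <-> P (ecns z e).
    by split; apply: supP => -[|i] //= /ltnW/ee'.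
  by move=> z /sP/hy; rewrite sP /e' eqxx.
have [e1 [X1e1 ee1 he1]] := omit_step chn he0 clI j dX1 X1e.
have [pj|npj] := pselect (pM (e1 j)).
  have [i Ii ji] := he1 pj; exists (fun e => X1 e /\ e j = e i); split.
  - by apply: dfb_and => //; exact: dfb_eq.
  - by exists e1 => //; split=> //; rewrite ji ee1.
  - by move=> e' [[]].
  - by move=> e' [[_ h] _]; exists w.
  - by move=> e' ee' [_ ji'] _; exists i => //; rewrite ji' ee'.
move: npj => /existsNP[Q /not_implyP[dQ /not_implyP[evQ nQ]]].
exists (fun e => X1 e /\ ~ Q (e j)); split.
- by apply: dfb_and => //; apply: dfb_not; exact: (dfb_ren (fun=> j) dQ).
- by exists e1.
- by move=> e' [[]].
- by move=> e' [[_ h] _]; exists w.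
- by move=> e' _ [_ nQ'] pj; case: nQ'; exact: pj.
Qed.

(** Stage [t] serves the formula [F t] and coordinate [t] together; saturation then meets the whole
    decreasing sequence of conditions by one environment. *)
Lemma omitting_env (I : pred nat) (e0 : nat -> M) :
  (forall n, exists w, n <= w /\ ~~ I w) ->
  (forall i, I i -> in_closure c (e0 i)) ->
  (forall i a, I i -> pM a -> isucc (e0 i) a \/ isucc a (e0 i) ->
     exists2 j, I j & a = e0 j) ->
  exists e, [/\ agree I e e0,
    forall P, dfb P -> exists w, forall y, P (ecns y e) -> P (ecns (e w) e) &
    forall j, pM (e j) -> exists2 i, I i & e j = e0 i].
Proof.
move=> fresh he0 clI; have [F [dF surjF]] := dfb_enum M cL.
pose good (X : (nat -> M) -> Prop) := dfb X /\ exists2 e, X e & agree I e e0.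
have step t X (gX : good X) := henkin_step fresh he0 clI t (dF t) gX.1 gX.2.
have good0 : good (fun=> True) by split; [exact: dfb_const | exists e0].
pose G := fix G n : {X | good X} := if n is t.+1 return {X | good X} then
    let w := cid (step t _ (svalP (G t))) in
    exist _ (sval w) (let: And5 h1 h2 _ _ _ := svalP w in conj h1 h2)
  else exist _ _ good0.
pose X n := sval (G n).
have hX t : [/\ forall e, X t.+1 e -> X t e,
    forall e, X t.+1 e -> exists w, forall y, F t (ecns y e) -> F t (ecns (e w) e) &
    forall e, agree I e e0 -> X t.+1 e -> pM (e t) -> exists2 i, I i & e t = e0 i].
  by rewrite /X /=; case: cid => ? [] /=.
have [s||s|e Xe ee0] := @saturated_env L M satM X I e0.
- by have [] := svalP (G s).
- move=> s t e /subnKC<-; elim: (t - s) => [|k IH]; first by rewrite addn0.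
  by rewrite addnS; have [h _ _] := hX (s + k); move=> /h/IH.
- by have [] := svalP (G s).
exists e; split=> // [P /surjF[t <-]|j].
  by have [_ h _] := hX t; exact: h.
by have [_ _ h] := hX j; exact: h.
Qed.

(** The hypothesis on immediate neighbours makes the embedded copy closed under neighbours in [M],
    as [omitting_env] requires. *)
Lemma model_of_order (X : Type) (g : X -> nat) (R : X -> X -> Prop) :
  injective g ->
  (forall x, ~ R x x) -> (forall x y z, R x y -> R y z -> R x z) ->
  (forall x y, [\/ R x y, x = y | R y x]) ->
  (forall x, (exists y, succ_in R x y) /\ (exists y, succ_in R y x)) ->
  exists N : elementary_substructure M, countable [set: N] /\
    exists f : X -> N, [/\ forall x, pM (sval (f x)),
      forall a : N, pM (sval a) -> exists x, f x = a,
      injective f & forall x y, R x y <-> lt (sval (f x)) (sval (f y))].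
Proof.
move=> g_inj irr tr tot succs.
pose R' i j := exists x y, [/\ g x = i, g y = j & R x y].
have R'E x y : R' (g x) (g y) <-> R x y.
  by split=> [[x' [y' [/g_inj-> /g_inj->]]]//|Rxy]; exists x, y.
have R'succ x y : succ_in R x y -> succ_in R' (g x) (g y).
  move=> [Rxy h]; split=> [|z]; first exact/R'E.
  case=> [[x1 [z1 [/g_inj-> <- xz]]]] /R'E zy.
  by apply: (h z1).
have [|||i j [x [y [<- <- _]]]|e [pe lt_e succ_e]] :=
  @embed_order (range g) R'.
- by move=> _ [x [y [<- /g_inj-> /irr]]].
- move=> _ _ _ [x [y [<- <- xy]]] [y' [z [/g_inj-> <- yz]]].
  by apply/R'E; exact: tr yz.
- move=> _ _ [x _ <-] [y _ <-]; rewrite !(propext (R'E _ _)).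
  by case: (tot x y) => [h|->|h];
    [constructor 1 | constructor 2 | constructor 3].
- by split; [exists x | exists y].
(* Numbers that code no point receive [c 0], which does not realize the limit type. *)
pose a n := if `[< range g n >] then e n else c 0.
have aE x : a (g x) = e (g x) by rewrite /a asboolT //; exists x.
have lin := chain_linear chn.
(* Even coordinates carry the embedded order; the odd ones remain free for Henkin witnesses. *)
have [||i b _ pb|E [agE tvE omE]] :=
  @omitting_env (fun i => ~~ odd i) (fun i => a i./2).
- by move=> n; exists n.*2.+1; rewrite /= odd_double; split=> //; lia.
- move=> i _; rewrite /a; case: asboolP => [[x _ <-]|_]; last by right; exists 0.
  by left; apply: pe; exists x.
- suff h : isucc (a i./2) b \/ isucc b (a i./2) -> exists x, b = e (g x).
    by move=> /h[x ->]; exists (g x).*2; rewrite ?odd_double // doubleK aE.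
  rewrite /a; case: asboolP => [[x _ <-]|_].
    have [[y /R'succ/succ_e xy] [z /R'succ/succ_e zx]] := succs x.
    case=> [/(imm_succ_inj_r chn xy)|/(imm_succ_inj_l chn zx)] <-.
      by exists y.
    by exists z.
  case=> /(limit_succ chn) h; exfalso; apply: (limit_neq_c chn _ (erefl (c 0)));
    exact/h.
have [N NE] := tarski_vaught tvE.
have NrangeE m : es_set N m -> exists k, E k = m.
  by rewrite NE => -[k _ <-]; exists k.
exists N; split.
  apply/countable_injP; have /choice[k hk] := fun x : N => NrangeE _ (svalP x).
  exists k => x y _ _ kxy; apply: eq_sig_hprop => [z|]; first exact: Prop_irrelevance.
  by rewrite -!hk kxy.
have Nx x : es_set N (e (g x)).
  by rewrite NE; exists (g x).*2 => //; rewrite agE ?odd_double //= doubleK aE.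
exists (fun x => exist _ (e (g x)) (Nx x)); split=> /=.
- by move=> x; apply: pe; exists x.
- move=> x px; have [j jx] := NrangeE _ (svalP x).
  have [|i _] := omE j; first by rewrite jx.
  rewrite jx /a; case: asboolP => [[y _ <-] xy|_ /(limit_neq_c chn px)//].
  by exists y; apply: eq_sig_hprop => [z|]; first exact: Prop_irrelevance.
- move=> x y /(congr1 sval)/= exy; have [lirr _ _] := lin.
  have Dx := limit_D chn (pe (g x) (ex_intro2 _ _ x I erefl)).
  by case: (tot x y) => // /R'E/lt_e; rewrite exy => h; exfalso;
    apply: lirr h; rewrite -exy.
- move=> x y; split=> [/R'E/lt_e//|lxy].
  have [lirr ltr _] := lin.
  have Dx z := limit_D chn (pe (g z) (ex_intro2 _ _ z I erefl)).
  case: (tot x y) => // [xy|/R'E/lt_e lyx]; exfalso; apply: (lirr (e (g x))) => //.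
    by rewrite {2}xy.
  exact: (ltr _ _ _ _ _ _ lxy lyx).
Qed.

End Models.

(** * Simple types *)

Lemma filter_finite_forall (I T : Type) (G : set_system T) (s : set I)
  (A : I -> set T) : Filter G -> finite_set s -> (forall i, s i -> G (A i)) ->
  G [set m | forall i, s i -> A i m].
Proof.
move=> FG /finite_setP[n /card_set_bijP[f [fs finj _]]] GA.
suff h k : G [set m | forall i, s i -> f i < k -> A i m].
  by apply: filterS (h n) => m hm i si; apply: hm => //; exact: fs.
elim: k => [|k IH]; first by apply: filterS filterT.
have [[i [si fi]]|ni] := pselect (exists i, s i /\ f i = k); last first.
  apply: filterS IH => m hm j sj.
  rewrite ltnS leq_eqVlt => /predU1P[fj|]; last exact: hm.
  by case: ni; exists j.
apply: filterS (filterI (GA i si) IH) => m [Am hm] j sj.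
rewrite ltnS leq_eqVlt => /predU1P[fj|]; last exact: hm.
by have -> : j = i by apply: finj; rewrite ?inE // fj.
Qed.

(** The filter of sets containing all but finitely many elements of [X] is proper because [X] is
    infinite; any ultrafilter above it will do. *)
Lemma ultrafilter_infinite (X : set nat) :
  (forall N, exists n, N <= n /\ X n) ->
  exists G : set_system nat, [/\ UltraFilter G, G X & forall A, ev A -> G A].
Proof.
move=> infX; pose F : set_system nat := [set A | ev (fun n => X n -> A n)].
have PF : ProperFilter F.
  split; first by move=> [N hN]; have [n [Nn /(hN n Nn)]] := infX N.
  split; first by exists 0.
    by move=> A B FA FB; apply: ev_imp (ev_and FA FB) => n [h1 h2] Xn; split; auto.
  by move=> A B AB; apply: ev_imp => n h /h/AB.
have [G [UG FG]] := ultraFilterLemma PF.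
exists G; split=> // [|A evA]; apply: FG; first by exists 0.
by apply: ev_imp evA.
Qed.

Section SimpleType.
Variables (L : language) (T : theory L) (M : structure L).
Hypothesis MT : models M T.

Lemma scons1 (X : Type) (a : X) :
  scons a (@snil X) = fun=> a.
Proof. by apply/funext => i; rewrite ord1 /scons unlift_none. Qed.

Lemma dfb_sat1 (phi : formula L 1) : dfb (fun e : nat -> M => sat1 phi (e 0)).
Proof.
exists 1, phi => e; rewrite /sat1 scons1.
by have -> // : (fun i : 'I_1 => e i) = fun=> e 0 by apply/funext => i; rewrite ord1.
Qed.

Lemma sat1_dfb (P : M -> Prop) : dfb (fun e => P (e 0)) ->
  exists phi : formula L 1, forall a, sat1 phi a <-> P a.
Proof.
move=> [n [phi h]]; exists (fren phi (fun=> ord0)) => a.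
by rewrite /sat1 scons1 sat_fren -(h (fun=> a)).
Qed.

Lemma tp_complete (a : M) : complete_type T (tp a).
Proof.
split=> [s _ stp|phi]; first by exists M, a; split=> // phi /stp.
by have [?|?] := pselect (sat1 phi a); [left | right].
Qed.

Lemma ultra_complete (c : nat -> M) (G : set_system nat) : UltraFilter G ->
  complete_type T [set phi | G [set n | sat1 phi (c n)]].
Proof.
move=> UG; split=> [s fs sG|phi]; last first.
  by have [|] := in_ultra_setVsetC [set n | sat1 phi (c n)] UG; [left | right].
have FG : Filter G by exact: filter_filter.
have [n hn] := filter_ex (filter_finite_forall FG fs sG).
by exists M, (c n).
Qed.

(** An ultrafilter limit of the types of the [c n] is adherent to them. It differs from each of
    them, since the type of [c n] contains a formula defining [c n], which holds at one index
    only. *)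
Lemma ultra_C_type (c : nat -> M) (C : set M) (G : set_system nat)
    (UG : UltraFilter G) : injective c -> (forall n, C (c n)) -> C `<=` dcl0 M ->
  (forall A, ev A -> G A) ->
  C_type C (exist _ _ (ultra_complete c UG) : stone1 T).
Proof.
move=> c_inj Cc Cdcl evG U; rewrite nbhsE => -[V [oV Vq] VU].
have [phi /= Gphi sV] := (oV : stone1_open V) _ Vq.
have [n phin] := filter_ex Gphi.
exists (exist _ _ (tp_complete (c n))); split; last by apply/VU/sV.
  apply/eqP => /(congr1 sval)/= E.
  have [psi hpsi] := Cdcl _ (Cc n).
  have {}hpsi a : sat1 psi a <-> a = c n.
    rewrite /sat1 scons1; have := congr1 (fun A => A (fun=> a)) hpsi => /= h.
    by rewrite -h.
  have : tp (c n) psi by apply/hpsi.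
  rewrite E /= => h1.
  have h2 : G [set m | m <> n] by apply: evG; exists n.+1 => m nm /= mn; lia.
  have [m [/hpsi/c_inj ? ?]] := filter_ex (filterI h1 h2).
  by [].
by exists (c n).
Qed.

(** If a formula and its negation both held infinitely often on [C], ultrafilters concentrated on
    either side would yield two distinct C-types. *)
Lemma simple_chain (p : stone1 T) (C D : set M) (lt : M -> M -> Prop) :
  simple_type p C D lt -> exists c : nat -> M, eventual_chain c D lt /\
    forall phi, sval p phi <-> ev (fun n => sat1 phi (c n)).
Proof.
move=> sp; have [c [[/(_ _ I) Cc' cinj' csurj] clt]] := simple_omega sp.
have Cc n : C (c n) by apply: (Cc' n).
have c_inj : injective c by move=> i j; apply: cinj'; rewrite inE.
have pG (G : set_system nat) : UltraFilter G -> (forall A, ev A -> G A) ->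
    forall phi, sval p phi <-> G [set n | sat1 phi (c n)].
  move=> UG evG phi.
  have qC := ultra_C_type (UG := UG) c_inj Cc (simple_C_dcl sp) evG.
  by rewrite -(simple_C_type_unique sp qC).
have evP (P : M -> Prop) : dfb (fun e => P (e 0)) ->
    ev (fun n => P (c n)) \/ ev (fun n => ~ P (c n)).
  move=> /sat1_dfb[phi hphi]; apply: contrapT => /not_orP[nP nnP].
  have [|G1 [U1 G1X ev1]] := @ultrafilter_infinite [set n | P (c n)].
    move=> N; apply: contrapT => h; apply: nnP; exists N => n Nn Pn.
    by apply: h; exists n.
  have [|G2 [U2 G2X ev2]] := @ultrafilter_infinite [set n | ~ P (c n)].
    move=> N; apply: contrapT => h; apply: nP; exists N => n Nn.
    by apply: contrapT => Pn; apply: h; exists n.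
  have : sval p phi.
    by apply/(pG _ U1 ev1); apply: filterS G1X => n; exact: (hphi _).2.
  move=> /(pG _ U2 ev2) h; have [n [/= /hphi]] := filter_ex (filterI h G2X).
  by [].
have [|G [UG _ evG]] := @ultrafilter_infinite setT; first by move=> N; exists N.
exists c; split; last first.
  move=> phi; rewrite (pG G UG evG); split=> [h|]; last exact: evG.
  have [//|/evG h'] := evP _ (dfb_sat1 phi).
  by have [n []] := filter_ex (filterI h h').
have [CD Cini] := simple_initial sp.
split=> //.
- by move=> n; exact: CD.
- by move=> i j; rewrite -clt ltEnat.
- move=> y n Dy yc; have [m _ <-] := csurj _ (Cini _ _ (Cc n) Dy yc).
  by exists m.
- exact: simple_linear sp.
- move=> n; have [phi hphi] := simple_C_dcl sp (Cc n); exists 1, phi => e.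
  exact: (propeqP _ _).1 (congr1 (fun A => A (fun i : 'I_1 => e i)) hphi).
- have [phi hphi] := simple_D_definable sp; exists 1, phi => e.
  by have := congr1 (fun A => A (fun i : 'I_1 => e i)) hphi => /= <-.
- have [phi hphi] := simple_lt_definable sp; exists 2, phi => e.
  by have := congr1 (fun A => A (fun i : 'I_2 => e i)) hphi => /= <-.
Qed.

Lemma realizations_limit (p : stone1 T) (c : nat -> M)
    (N : elementary_substructure M) (a : N) :
  (forall phi, sval p phi <-> ev (fun n => sat1 phi (c n))) ->
  realizations p N a <-> limit_point_of c (sval a).
Proof.
move=> hp.
have satN phi : sat1 phi a <-> sat1 phi (sval a).
  by rewrite /sat1 !scons1; exact: es_elementary.
split=> [ha P /[dup] dP /sat1_dfb[phi hphi] evP|ha phi /hp].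
  apply/hphi/satN/ha/hp; apply: ev_imp evP => n; exact: (hphi _).2.
by move/(ha _ (dfb_sat1 phi))/satN.
Qed.

End SimpleType.

(** * Continuum many discrete orders *)

Definition order_iso (X Y : Type) (R : X -> X -> Prop) (S : Y -> Y -> Prop) :=
  exists (h : X -> Y) (k : Y -> X),
    [/\ cancel h k, cancel k h & forall x y, R x y <-> S (h x) (h y)].

Lemma order_iso_sym (X Y : Type) (R : X -> X -> Prop) (S : Y -> Y -> Prop) :
  order_iso R S -> order_iso S R.
Proof.
by move=> [h [k [hk kh hR]]]; exists k, h; split=> // x y; rewrite hR !kh.
Qed.

Lemma succ_in_iso (X Y : Type) (R : X -> X -> Prop) (S : Y -> Y -> Prop)
  (h : X -> Y) (k : Y -> X) : cancel k h ->
  (forall x y, R x y <-> S (h x) (h y)) ->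
  forall x y, succ_in R x y -> succ_in S (h x) (h y).
Proof.
move=> kh hR x y [xy ny]; split=> [|z]; first exact/hR.
by rewrite -(kh z) -!(propext (hR _ _)); exact: ny.
Qed.

Definition strict_linear (X : Type) (R : X -> X -> Prop) : Prop :=
  [/\ forall x, ~ R x x, forall x y z, R x y -> R y z -> R x z
    & forall x y, [\/ R x y, x = y | R y x]].

(** * Lexicographic products with Z *)

Section LexInt.
Variables (X : Type) (R : X -> X -> Prop).
Hypothesis linR : strict_linear R.

Definition lex_int (x y : X * int) : Prop :=
  R x.1 y.1 \/ (x.1 = y.1 /\ (x.2 < y.2)%R).

Lemma lex_int_linear : strict_linear lex_int.
Proof.
have [irr tr tot] := linR; split=> [[x i]|[x i] [y j] [z k]|[x i] [y j]];
  rewrite /lex_int /=.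
- by move=> [/irr//|[_]]; lia.
- move=> [xy|[<- ij]] [yz|[<- jk]]; [|by left|by left|right; split=> //; lia].
  by left; exact: tr yz.
have [xy|->|yx] := tot x y; [by constructor 1; left| |by constructor 3; left].
have [ij|->|ji] : [\/ (i < j)%R, i = j | (j < i)%R].
- by case: (Order.TotalTheory.ltgtP i j) => h;
    [constructor 1 | constructor 3 | constructor 2].
- by constructor 1; right.
- by constructor 2.
- by constructor 3; right.
Qed.

Lemma lex_int_succ x (i : int) : succ_in lex_int (x, i) (x, (i + 1)%R).
Proof.
have [irr tr _] := linR; split; first by right; split=> //=; lia.
move=> [y j]; rewrite /lex_int /= => -[[xy|[<- ij]] [yx|[yx ji]]].
- by apply: (irr x); exact: tr yx.
- by rewrite yx in xy; exact: irr xy.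
- exact: irr yx.
- lia.
Qed.

End LexInt.

(** Isomorphisms preserve immediate successors, and the successor of a point lies in the same copy
    of Z. Hence copies go into copies, and contracting them recovers the original order. *)
Lemma lex_int_iso_fst (X Y : Type) (R : X -> X -> Prop) (S : Y -> Y -> Prop)
  (h : X * int -> Y * int) (k : Y * int -> X * int) :
  strict_linear R -> strict_linear S -> cancel k h ->
  (forall x y, lex_int R x y <-> lex_int S (h x) (h y)) ->
  forall x i, (h (x, i)).1 = (h (x, 0%R)).1.
Proof.
move=> linR linS kh hR x.
have step i : (h (x, (i + 1)%R)).1 = (h (x, i)).1.
  have [_ _ tot] := lex_int_linear linS.
  have [l1 s1] := succ_in_iso kh hR (lex_int_succ linR x i).
  have := lex_int_succ linS (h (x, i)).1 (h (x, i)).2; rewrite -surjective_pairing.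
  move=> [l2 s2].
  have [l|->//|l] := tot (h (x, (i + 1)%R)) ((h (x, i)).1, ((h (x, i)).2 + 1)%R).
    by case: (s2 (h (x, (i + 1)%R))).
  by case: (s1 ((h (x, i)).1, ((h (x, i)).2 + 1)%R)).
have pos (n : nat) : (h (x, Posz n)).1 = (h (x, 0%R)).1.
  by elim: n => // n <-; rewrite -[RHS]step; congr (h (x, _)).1; lia.
case=> n; first exact: pos.
elim: n => [|n IH]; first by rewrite -[LHS]step.
by rewrite -IH -[LHS]step; congr (h (x, _)).1; lia.
Qed.

Lemma lex_int_iso (X Y : Type) (R : X -> X -> Prop) (S : Y -> Y -> Prop) :
  strict_linear R -> strict_linear S ->
  order_iso (lex_int R) (lex_int S) -> order_iso R S.
Proof.
move=> linR linS [h [k [hk kh hR]]].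
have kR x y : lex_int S x y <-> lex_int R (k x) (k y) by rewrite hR !kh.
have hf := lex_int_iso_fst linR linS kh hR.
have kf := lex_int_iso_fst linS linR hk kR.
pose f x := (h (x, 0%R)).1; pose g y := (k (y, 0%R)).1.
have fK : cancel f g.
  move=> x; rewrite /g -(kf _ (h (x, 0%R)).2) /f -surjective_pairing.
  by rewrite hk.
have gK : cancel g f.
  move=> y; rewrite /f -(hf _ (k (y, 0%R)).2) /g -surjective_pairing.
  by rewrite kh.
have [irrR trR totR] := linR; have [irrS trS totS] := linS.
have fR x y : R x y -> S (f x) (f y).
  move=> xy; have [//|[E _]] : lex_int S (h (x, 0%R)) (h (y, 0%R)) by apply/hR; left.
  by move: xy; rewrite -(fK x) [f x]E fK => /irrR.
exists f, g; split=> // x y; split; first exact: fR.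
have [//|->/irrS//|/fR yx xy] := totR x y.
by case: (irrS (f x)); exact: trS yx.
Qed.

(** Immediate successors are unique in a linear order, so there this counts exactly the steps
    available upwards from [x]. *)
Fixpoint ends_after (X : Type) (R : X -> X -> Prop) n (x : X) : Prop :=
  if n is n'.+1 then exists y, succ_in R x y /\ ends_after R n' y
  else ~ exists y, succ_in R x y.

(* There is a maximal chain of immediate successors with [n + 2] elements. *)
Definition has_block (X : Type) (R : X -> X -> Prop) n : Prop :=
  exists x, (~ exists y, succ_in R y x) /\ ends_after R n.+1 x.

Lemma has_block_iso (X Y : Type) (R : X -> X -> Prop) (S : Y -> Y -> Prop) n :
  order_iso R S -> has_block R n -> has_block S n.
Proof.
move=> [h [k [hk kh hR]]].
have kR x y : S x y <-> R (k x) (k y) by rewrite hR !kh.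
have hs := succ_in_iso kh hR; have ks := succ_in_iso hk kR.
have he m x : ends_after R m x -> ends_after S m (h x).
  elim: m x => [|m IH] x /=.
    by move=> nx [y /ks]; rewrite hk => h'; apply: nx; exists (k y).
  by move=> [y [xy /IH ey]]; exists (h y); split=> //; exact: hs.
move=> [x [nx /he ex]]; exists (h x); split=> // -[y /ks].
by rewrite hk => yx; apply: nx; exists (k y).
Qed.

(* For each [i], a copy of the rationals, followed by a chain of [i + 2]
   elements when [b i] holds. *)
Section Blocks.
Variable b : nat -> bool.
Import Order.TTheory GRing.Theory Num.Theory.

Definition in_blocks (x : nat * (rat + nat)) : bool :=
  if x.2 is inr m then b x.1 && (m < x.1.+2) else true.

Definition blocks := {x | in_blocks x}.

Definition lt_in_block (s t : rat + nat) : Prop :=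
  match s, t with
  | inl q, inl r => (q < r)%R
  | inl _, inr _ => True
  | inr _, inl _ => False
  | inr m, inr n => m < n
  end.

Definition lt_blocks (x y : blocks) : Prop :=
  (sval x).1 < (sval y).1 \/
  ((sval x).1 = (sval y).1 /\ lt_in_block (sval x).2 (sval y).2).

Lemma lt_blocks_linear : strict_linear lt_blocks.
Proof.
split.
- move=> [[i [q|m]] hx]; rewrite /lt_blocks /= ?ltxx ltnn.
    by case=> [|[]].
  by case=> [|[_]]; rewrite ?ltnn.
- move=> [[i s] hx] [[j t] hy] [[k u] hz]; rewrite /lt_blocks /=.
  move=> [ij|[<- st]] [jk|[<- tu]]; [left; lia|by left|by left|right; split=> //].
  case: s t u st tu {hx hy hz} => [q|m] [r|n] [p|o] //=; [lra|lia].
move=> [[i s] hx] [[j t] hy].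
have E : (i, s) = (j, t) -> exist in_blocks (i, s) hx = exist _ (j, t) hy.
  by move=> E; apply: val_inj.
rewrite /lt_blocks /=; have [ij|ji|ij] := ltngtP i j.
- by constructor 1; left.
- by constructor 3; left.
subst j; case: s t hx hy E => [q|m] [r|n] hx hy E /=.
- have [qr|rq|qr] := ltgtP q r;
    [by constructor 1; right | by constructor 3; right | constructor 2].
  by apply: E; rewrite qr.
- by constructor 1; right.
- by constructor 3; right.
have [mn|nm|mn] := ltngtP m n;
  [by constructor 1; right | by constructor 3; right | constructor 2].
by apply: E; rewrite mn.
Qed.

Definition rat_pt i (q : rat) : blocks := exist in_blocks (i, inl q) isT.

Lemma no_succ_rat i q : ~ exists y, succ_in lt_blocks (rat_pt i q) y.
Proof.
move=> [[[j s] hy] [+ ny]]; rewrite /lt_blocks /= => xy.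
have [r [qr ry]] : exists r : rat,
    (q < r)%R /\ lt_blocks (rat_pt i r) (exist _ (j, s) hy).
  case: xy => [ij|[ij]]; first by exists (q + 1)%R; split; [lra | left].
  case: s hy {ny} => [r|m] hy /= qr; last by exists (q + 1)%R; split; [lra | right].
  by exists ((q + r) / 2)%R; split; [lra | right; split=> //=; lra].
by apply: (ny (rat_pt i r)); split=> //; right.
Qed.

(** Rational points and first elements of chains are limits from below of rationals in the same
    block. *)
Lemma no_pred i s hx : (if s is inr m then m = 0 else True) ->
  ~ exists y, succ_in lt_blocks y (exist in_blocks (i, s) hx).
Proof.
move=> hs [[[j t] hy] [+ ny]]; rewrite /lt_blocks /= => xy.
have [r [ry xr]] : exists r : rat,
    lt_blocks (exist _ (j, t) hy) (rat_pt i r) /\ lt_in_block (inl r) s.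
  case: s hs hx {ny} xy => [q|m] hs hx xy.
    case: xy => [ji|[ji]]; first by exists (q - 1)%R; split; [left | rewrite /=; lra].
    case: t hy => [p|n] hy //= pq.
    by exists ((p + q) / 2)%R; split; [right; split=> //=; lra | rewrite /=; lra].
  case: xy => [ji|[ji]]; first by exists 0%R; split; [left|].
  case: t hy => [p|n] hy /=; last by rewrite hs.
  by move=> _; exists (p + 1)%R; split=> //; right; split=> //=; lra.
by apply: (ny (rat_pt i r)); split=> //; right.
Qed.

Lemma succ_block i m hx hy :
  succ_in lt_blocks (exist in_blocks (i, inr m) hx) (exist _ (i, inr m.+1) hy).
Proof.
split; first by right; split=> /=.
move=> [[j [r|n]] hz]; rewrite /lt_blocks /=; last lia.
by case=> -[?|[? ?]] [?|[? ?]] //; lia.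
Qed.

(** Every later block begins with a copy of the rationals, which has no first element. *)
Lemma no_succ_last i hx :
  ~ exists y, succ_in lt_blocks (exist in_blocks (i, inr i.+1) hx) y.
Proof.
move=> [[[j s] hy] [+ ny]]; rewrite /lt_blocks /= => -[ij|[ij]]; last first.
  case: s hy {ny} => [r|m] hy //=; move: hy; rewrite /in_blocks /= => /andP[_]; lia.
case: s hy ny => [r|m] hy ny.
  apply: (ny (rat_pt j (r - 1)%R)); split; first by left.
  by right; split=> //=; lra.
by apply: (ny (rat_pt j 0%R)); split; [left | right].
Qed.

Lemma ends_after_block k i m hx :
  ends_after lt_blocks k (exist in_blocks (i, inr m) hx) <-> m + k = i.+1.
Proof.
have [irr tr tot] := lt_blocks_linear.
have /andP[bi mi] : b i && (m < i.+2) := hx.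
elim: k m hx {mi} => [|k IH] m hx /=; have /andP[_ mi] : b i && (m < i.+2) := hx.
  split=> [nx|]; last first.
    by rewrite addn0 => E; subst m; exact: no_succ_last.
  apply: contrapT => ne; apply: nx.
  have hy : in_blocks (i, inr m.+1) by rewrite /in_blocks /= bi; lia.
  by exists (exist in_blocks _ hy); exact: succ_block.
split=> [[y [xy ey]]|E].
  have [E|ne] := eqVneq m i.+1.
    by subst m; case: (@no_succ_last i hx); exists y.
  have hy : in_blocks (i, inr m.+1) by rewrite /in_blocks /= bi; lia.
  have [l1 s1] := xy; have [l2 s2] := succ_block hx hy.
  have [l|yE|l] := tot y (exist in_blocks _ hy); first by case: (s2 y).
    by move: ey; rewrite yE => /IH; lia.
  by case: (s1 (exist in_blocks _ hy)).
have hy : in_blocks (i, inr m.+1) by rewrite /in_blocks /= bi; lia.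
exists (exist in_blocks _ hy); split; [exact: succ_block | apply/IH; lia].
Qed.

(** Chains have at least two elements because a rational point, having neither neighbour, would look
    like a chain with one. The length of a chain then identifies its block. *)
Lemma has_blockP n : has_block lt_blocks n <-> b n.
Proof.
split=> [[[[i [q|m]] hx] [np]]|bn].
- move=> [y [sy _]]; case: (@no_succ_rat i q); exists y.
  by move: sy; congr succ_in; apply: val_inj.
- move=> /ends_after_block E.
  have /andP[bi mi] : b i && (m < i.+2) := hx.
  case: m hx np E mi => [|m] hx np E mi; first by have -> : n = i by lia.
  have hy : in_blocks (i, inr m) by rewrite /in_blocks /= bi; lia.
  by case: np; exists (exist in_blocks _ hy); exact: succ_block.
have hx : in_blocks (n, inr 0) by rewrite /in_blocks /= bn.
exists (exist in_blocks _ hx); split; first exact: no_pred.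
by apply/ends_after_block; lia.
Qed.

End Blocks.

Lemma lex_blocks_inj (b b' : nat -> bool) :
  order_iso (lex_int (@lt_blocks b)) (lex_int (@lt_blocks b')) -> b = b'.
Proof.
move=> /(lex_int_iso (lt_blocks_linear b) (lt_blocks_linear b')) iso.
apply/funext => n; apply/idP/idP => /has_blockP h; apply/has_blockP.
  exact: has_block_iso iso h.
exact: has_block_iso (order_iso_sym iso) h.
Qed.

(** * Isomorphism classes of countable structures *)

Section Isomorphism.
Variable L : language.
Implicit Types M N : structure L.

Definition is_iso M N (h : M -> N) : Prop := [/\ bijective h,
    forall f (v : 'I_(fsym_arity f) -> M),
      h (fun_of M f v) = fun_of N f (fun i => h (v i))
  & forall r (v : 'I_(rsym_arity r) -> M),
      rel_of M r v <-> rel_of N r (fun i => h (v i))].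

Lemma isomorphic_refl M : isomorphic M M.
Proof. by exists id; split=> //; exists id. Qed.

Lemma is_iso_inv M N (h : M -> N) k : is_iso h -> cancel h k -> cancel k h ->
  is_iso k.
Proof.
move=> [_ hf hr] hk kh; split; first by exists h.
  move=> f v; rewrite -[RHS]hk hf; congr (k (fun_of N f _)).
  by apply/funext => i; rewrite kh.
move=> r v; rewrite hr; have -> // : (fun i => h (k (v i))) = v.
by apply/funext => i; rewrite kh.
Qed.

Lemma isomorphic_sym M N : isomorphic M N -> isomorphic N M.
Proof.
move=> [h ih]; have [[k hk kh] _ _] := ih.
by exists k; exact: is_iso_inv ih hk kh.
Qed.

Lemma isomorphic_trans M N N' : isomorphic M N -> isomorphic N N' -> isomorphic M N'.
Proof.
move=> [h [bh hf hr]] [k [bk kf kr]]; exists (k \o h); split.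
- exact: bij_comp.
- by move=> f v /=; rewrite hf kf.
- by move=> r v; rewrite hr kr.
Qed.

Lemma sat_iso M N (h : M -> N) : is_iso h ->
  forall n (phi : formula L n) v, sat M phi v <-> sat N phi (fun i => h (v i)).
Proof.
move=> [[k hk kh] hf hr] n phi.
have evalE n' (t : term L n') v : h (teval v t) = teval (fun i => h (v i)) t.
  elim: t => //= f ts IH; rewrite hf; congr fun_of; apply/funext => i; exact: IH.
elim: phi => {n} [n|n t u|n r ts|n a IHa b IHb|n a IHa] v //=.
- by rewrite -!evalE; split=> [->|/(can_inj hk)].
- rewrite hr; have -> // : (fun i => h (teval v (ts i))) =
    fun i => teval (fun i => h (v i)) (ts i) by apply/funext => i; rewrite evalE.
- by rewrite (propext (IHa v)) (propext (IHb v)).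
have E x : (fun i => h (scons x v i)) = scons (h x) (fun i => h (v i)).
  by apply/funext => i; rewrite /scons; case: unliftP.
split=> hx x; last by apply/IHa; rewrite E.
by have /IHa := hx (k x); rewrite E kh.
Qed.

(** * Complete diagrams as codes of countable structures *)

Section Codes.
Variable code : {n & formula L n} -> nat.
Hypothesis code_inj : injective code.

(** The complete diagram of [N], with elements named by [g], as a set of numbers. It bounds the
    number of isomorphism classes by the continuum. *)
Definition diagram N (g : N -> nat) : nat -> Prop := fun k =>
  exists (x : {n & formula L n}) (w : 'I_(projT1 x) -> N),
    k = pickle (code x, [seq g (w i) | i <- enum 'I_(projT1 x)]) /\
    sat N (projT2 x) w.

Lemma diagram_sat N N' (g : N -> nat) (g' : N' -> nat) :
  diagram g = diagram g' -> forall n (phi : formula L n) w, sat N phi w ->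
  exists w', (forall i, g' (w' i) = g (w i)) /\ sat N' phi w'.
Proof.
move=> eqd n phi w s.
have : diagram g (pickle (code (existT _ n phi), [seq g (w i) | i <- enum 'I_n])).
  by exists (existT _ n phi), w.
rewrite eqd => -[y [w' [/(pcan_inj pickleK)[/code_inj E] h s']]].
case: y / E w' h s' => /= w' /eq_in_map h s'; exists w'; split=> // i.
by apply/esym/h; rewrite mem_enum.
Qed.

Lemma diagram_iso N N' (g : N -> nat) (g' : N' -> nat) :
  injective g -> injective g' -> diagram g = diagram g' -> isomorphic N N'.
Proof.
move=> gi gi' eqd.
have ex (K K' : structure L) (u : K -> nat) (u' : K' -> nat) :
    diagram u = diagram u' -> forall a, exists a', u' a' = u a.
  (* The formula [x_0 = x_0] makes the name of every element occur in the diagram. *)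
  move=> eq_u a; have [|w' [h _]] := @diagram_sat _ _ _ _ eq_u 1
    (feq (tvar L ord0) (tvar L ord0)) (fun=> a); first by [].
  by exists (w' ord0).
have /choice[h hg] := ex _ _ _ _ eqd; have /choice[k kg] := ex _ _ _ _ (esym eqd).
have hsat n (phi : formula L n) w : sat N phi w -> sat N' phi (fun i => h (w i)).
  move=> /(diagram_sat eqd)[w' [hw']]; have -> // : w' = fun i => h (w i).
  by apply/funext => i; apply: gi'; rewrite hw' hg.
exists h; split.
- by exists k => x; [apply: gi; rewrite kg hg | apply: gi'; rewrite hg kg].
- move=> f v.
  have /= := @hsat _ (feq (tvar L ord0) (tapp (fun i => tvar L (lift ord0 i))))
    (scons (fun_of N f v) v).
  rewrite /scons unlift_none /=.
  have E (K : structure L) (a : K) (x : 'I_(fsym_arity f) -> K) :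
      (fun i => oapp x a (unlift ord0 (lift ord0 i))) = x.
    by apply/funext => i; rewrite liftK.
  rewrite E => -> //; congr fun_of; apply/funext => i; by rewrite liftK.
- move=> r v; pose phi := @Defs.frel L _ r (fun i => tvar L i).
  split=> [|h']; first exact: (@hsat _ phi).
  by apply: contrapT => nr; exact: (@hsat _ (fneg phi) v).
Qed.

End Codes.

(** A structure has a diagram for each numbering. The diagrams of all its isomorphic copies form a
    set that depends only on the isomorphism class, and the invariant is an element chosen from
    it. *)
Lemma isomorphism_invariant : countable_language L ->
  exists inv : structure L -> (nat -> bool),
    forall N N', countable [set: N] -> countable [set: N'] ->
      (inv N = inv N' <-> isomorphic N N').
Proof.
move=> /formula_code[code code_inj].
pose cls N : set (nat -> bool) := [set k | exists (N' : structure L) (g : N' -> nat),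
  [/\ injective g, isomorphic N N' & k = fun n => `[< diagram code g n >]]].
have clsN N : countable [set: N] -> cls N (xget (fun=> false) (cls N)).
  move=> /countable_type_inj[g g_inj]; apply: (@xgetPex _ _ (cls N)).
  by exists (fun n => `[< diagram code g n >]), N, g; split=> //; exact: isomorphic_refl.
exists (fun N => xget (fun=> false) (cls N)) => N N' cN cN'; split=> [E|iso].
  have := clsN N cN; have := clsN N' cN'; rewrite E.
  move=> [K' [g' [gi' iso' ->]]] [K [g [gi iso Eg]]].
  apply: isomorphic_trans (isomorphic_sym iso'); apply: isomorphic_trans iso _.
  apply: (diagram_iso code_inj gi gi'); apply/funext => n.
  apply: propext; apply: asbool_eq_equiv.
  exact: (congr1 (fun f : nat -> bool => f n) (esym Eg)).
congr xget; apply/seteqP; split=> k [K [g [gi isoK ->]]]; exists K, g; split=> //.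
  exact: isomorphic_trans (isomorphic_sym iso) isoK.
exact: isomorphic_trans iso isoK.
Qed.

End Isomorphism.

(** The invariants of countable models form a subset of [nat -> bool] into which [G] embeds
    [nat -> bool]. Cantor-Bernstein gives a bijection, along which representatives are chosen. *)
Lemma continuum_many_models (L : language) (T : theory L)
    (G : (nat -> bool) -> structure L) : countable_language L ->
  (forall b, models (G b) T /\ countable [set: G b]) ->
  (forall b b', isomorphic (G b) (G b') -> b = b') ->
  number_of_countable_models T (nat -> bool).
Proof.
move=> cL hG Ginj; have [inv invP] := isomorphism_invariant cL.
pose good N := models N T /\ countable [set: N].
pose A : set (nat -> bool) := [set k | exists N, good N /\ inv N = k].
have : ([set: nat -> bool] #= A)%card.
  apply: Cantor_Bernstein; last exact: subset_card_le.
  have f_inj : {in [set: nat -> bool] &, injective (inv \o G)}.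
    move=> b b' _ _ /= E; apply: Ginj.
    exact: (invP _ _ (hG b).2 (hG b').2).1.
  rewrite -(card_le_eql (inj_card_eq f_inj)); apply: subset_card_le.
  by move=> _ [b _ <-]; exists (G b); split=> //; exact: hG.
move=> /card_set_bijP[u [uA u_inj u_surj]].
have /choice[F hF] : forall k, exists N, good N /\ inv N = u k.
  by move=> k; exact: (uA k I).
exists F; split=> [k|k l iso|N NT cN].
- exact: (hF k).1.
- apply: u_inj; rewrite ?inE // -(hF k).2 -(hF l).2.
  exact: (invP _ _ (hF k).1.2 (hF l).1.2).2.
have [k _ uk] := u_surj (inv N) (ex_intro _ N (conj (conj NT cN) erefl)).
exists k; apply: (invP _ _ cN (hF k).1.2).1.
by rewrite (hF k).2.
Qed.

(** The isomorphism need not extend to [M], but the limit type and [lt] are given by formulas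
    without parameters, whose truth is the same in [M] and in its elementary substructures. *)
Lemma iso_orders (L : language) (M : structure L) (c : nat -> M) (D : set M)
    (lt : M -> M -> Prop) : eventual_chain c D lt ->
  forall (N N' : elementary_substructure M), isomorphic N N' ->
  forall (X X' : Type) (R : X -> X -> Prop) (R' : X' -> X' -> Prop)
    (f : X -> N) (f' : X' -> N'),
  (forall x, limit_point_of c (sval (f x))) ->
  (forall a : N, limit_point_of c (sval a) -> exists x, f x = a) ->
  injective f ->
  (forall x y, R x y <-> lt (sval (f x)) (sval (f y))) ->
  (forall x, limit_point_of c (sval (f' x))) ->
  (forall a : N', limit_point_of c (sval a) -> exists x, f' x = a) ->
  injective f' ->
  (forall x y, R' x y <-> lt (sval (f' x)) (sval (f' y))) ->
  order_iso R R'.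
Proof.
move=> chn N N' [h ih] X X' R R' f f' pf sf fi fR pf' sf' fi' fR'.
have [[k hk kh] _ _] := ih; have ik := is_iso_inv ih hk kh.
have iso_dfb (K K' : elementary_substructure M) (u : K -> K') : is_iso u ->
    forall P : (nat -> M) -> Prop, dfb P -> forall e,
    P (fun i => sval (e i)) <-> P (fun i => sval (u (e i))).
  move=> iu P [n [phi hphi]] e; rewrite !hphi -2!(propext (es_elementary _ _)).
  exact: sat_iso.
have iso_pM (K K' : elementary_substructure M) (u : K -> K') : is_iso u ->
    forall a, limit_point_of c (sval a) -> limit_point_of c (sval (u a)).
  move=> iu a pa P dP /(pa P dP).
  exact: (iso_dfb _ _ _ iu _ dP (fun=> a)).1.
have /choice[s hs] : forall x, exists y, f' y = h (f x).
  by move=> x; apply: sf'; apply: iso_pM.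
have /choice[t ht] : forall y, exists x, f x = k (f' y).
  by move=> y; apply: sf; apply: iso_pM.
exists s, t; split=> [x|y|x y].
- by apply: fi; rewrite ht hs hk.
- by apply: fi'; rewrite hs ht kh.
rewrite fR fR' !hs.
exact: (iso_dfb _ _ _ ih _ (chain_dfb_lt chn) (fun i => if i is 0 then f x else f y)).
Qed.

Theorem theorem2 (L : language) (T : theory L) (M : structure L)
    (p : stone1 T) (C D : set M) (lt : M -> M -> Prop) :
  countable_language L ->
  complete_theory T ->
  has_infinite_model T ->
  monster_model T M ->
  simple_type p C D lt ->
  (forall (d : Order.disp_t) (O : orderType d),
      countable [set: O] -> discrete_order O -> without_endpoints O ->
      exists N : elementary_substructure M,
        [/\ countable [set: N], models N T
          & has_order_type (realizations p N)
              (fun x y : N => lt (sval x) (sval y)) O])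
  /\ number_of_countable_models T (nat -> bool).
Proof.
move=> cL _ _ [MT satM] sp; have [c [chn pE]] := simple_chain MT sp.
have NT (N : elementary_substructure M) : models N T.
  move=> phi /MT; rewrite /holds (propext (es_elementary _ _)).
  have -> // : (fun i => sval (@snil N i)) = @snil M.
  by apply/funext => -[].
split=> [d O /countable_type_inj[g g_inj] discO noendO|].
  have [|||x|N [cN [f [pf sf fi fR]]]] := model_of_order chn cL satM
    (R := fun x y : O => (x < y)%O) g_inj.
  - by move=> x; rewrite Order.POrderTheory.ltxx.
  - by move=> x y z; exact: Order.POrderTheory.lt_trans.
  - move=> x y; case: (Order.TotalTheory.ltgtP x y) => h;
      by [constructor 1|constructor 3|constructor 2].
  - have [below above] := noendO x; have [succ pred] := discO x.
    by split; [apply: succ | apply: pred].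
  exists N; split=> //; exists f; split=> //; split=> [x _|x y _ _|a].
  - exact/(realizations_limit _ pE).
  - exact: fi.
  - by move=> /(realizations_limit _ pE)/sf[x <-]; exists x.
have hmod (b : nat -> bool) := model_of_order chn cL satM
  (R := lex_int (@lt_blocks b)) (g := pickle) (pcan_inj pickleK).
have /choice[G hG] : forall b : nat -> bool, exists N : elementary_substructure M,
    countable [set: N] /\ exists f : blocks b * int -> N,
    [/\ forall x, limit_point_of c (sval (f x)),
      forall a : N, limit_point_of c (sval a) -> exists x, f x = a,
      injective f &
      forall x y, lex_int (@lt_blocks b) x y <-> lt (sval (f x)) (sval (f y))].
  move=> b; have [irr tr tot] := lex_int_linear (lt_blocks_linear b).
  apply: hmod => // -[x i]; split; first by exists (x, (i + 1)%R);
    exact: lex_int_succ (lt_blocks_linear b) x i.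
  exists (x, (i - 1)%R); have := lex_int_succ (lt_blocks_linear b) x (i - 1)%R.
  by rewrite GRing.subrK.
apply: (@continuum_many_models _ _ (fun b => G b)) => // [b|b b' iso].
  by split; [exact: NT | exact: (hG b).1].
have [_ [f [pf sf fi fR]]] := hG b; have [_ [f' [pf' sf' fi' fR']]] := hG b'.
apply: lex_blocks_inj.
exact: (iso_orders chn iso pf sf fi fR pf' sf' fi' fR').
Qed.
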